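(* Let $\{x_t,y_t\}_{t\ge0}$ be the sequence generated by the PO-LMO algorithm (described in the context) with positive nonincreasing stepsizes $\tau_t=\Theta((t+1)^{-a})$, with $\beta_t=C(t+1)^{-b}$ (where $C>0$ is any constant) or $\beta_t=0$ where indicated, and with $\sigma=\tau_0$ in the definition of $G^{\mathrm{PO}}_{\mathcal X}$. The following hold for every $T\ge1$, with constants hidden in $O(\cdot)$, $\widetilde O(\cdot)$ independent of $T$. (i) (Nonconvex-concave.) If the standing assumption holds and $a=\frac23$, $b=\frac16$, then $$\frac1{T+1}\sum_{t=0}^TG^{\mathrm{PO}}_{\mathcal X}(x_t,y_t)\le\widetilde O(T^{-1/6}),\qquad \frac1{T+1}\sum_{t=0}^TG_{\mathcal Y}(x_t,y_t)\le\widetilde O(T^{-1/6}).$$ (ii) (Nonconvex-strongly concave.) If the standing assumption holds with $\mu>0$, and $a=\frac12$, $\beta_t=0$ for all $t$, then $$\frac1{T+1}\sum_{t=0}^TG^{\mathrm{PO}}_{\mathcal X}(x_t,y_t)\le O(T^{-1/4}),\qquad \frac1{T+1}\sum_{t=0}^TG_{\mathcal Y}(x_t,y_t)\le\widetilde O(T^{-1/2}).$$ (iii) (Nonconvex-concave, strongly convex $\mathcal Y$.) If the standing assumption holds, $\mathcal Y$ is an $\alpha$-strongly convex set for some $\alpha>0$, and $a=\frac35$, $b=\frac15$, then $$\frac1{T+1}\sum_{t=0}^TG^{\mathrm{PO}}_{\mathcal X}(x_t,y_t)\le O(T^{-1/5}),\qquad \frac1{T+1}\sum_{t=0}^TG_{\mathcal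 Y}(x_t,y_t)\le O(T^{-1/5}).$$ (iv) (Nonconvex-strongly concave, strongly convex $\mathcal Y$.) If the standing assumption holds with $\mu>0$, $\mathcal Y$ is an $\alpha$-strongly convex set for some $\alpha>0$, and $a=\frac13$, $\beta_t=0$ for all $t$, then $$\frac1{T+1}\sum_{t=0}^TG^{\mathrm{PO}}_{\mathcal X}(x_t,y_t)\le O(T^{-1/3}),\qquad \frac1{T+1}\sum_{t=0}^TG_{\mathcal Y}(x_t,y_t)\le\widetilde O(T^{-2/3}).$$
   Context: Notation: $\|\cdot\|$ is the Euclidean norm; $\widetilde O$ suppresses factors polynomial in $\log(T+2)$; $\tau_t=\Theta((t+1)^{-a})$ means $c_1(t+1)^{-a}\le\tau_t\le c_2(t+1)^{-a}$ for all $t\ge 0$ and some constants $0<c_1\le c_2$. Standing assumption. $\mathcal X\subset\mathbb R^{d_x}$ and $\mathcal Y\subset\mathbb R^{d_y}$ are nonempty compact convex sets with diameters $D_{\mathcal X}$, $D_{\mathcal Y}$. The payoff $\mathcal L:\mathbb R^{d_x}\times\mathbb R^{d_y}\to\mathbb R$ is continuously differentiable on an open set containing $\mathcal X\times\mathcal Y$; for some $\mu\ge 0$ and every $x\in\mathcal X$, $\mathcal L(x,\cdot)$ is $\mu$-strongly concave on $\mathcal Y$ ($\mu=0$ meaning concave); and there are $L_{xx},L_{yy}\ge 0$, $L_{yx}>0$ such that for all $(x,y),(x',y')\in\mathcal X\times\mathcal Y$, $\|\nabla_x\mathcal L(x,y)-\nabla_x\mathcal L(x',y')\|\le L_{xx}\|x-x'\|+L_{yx}\|y-y'\|$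 and $\|\nabla_y\mathcal L(x,y)-\nabla_y\mathcal L(x',y')\|\le L_{yx}\|x-x'\|+L_{yy}\|y-y'\|$. No convexity in $x$ is assumed. Strongly convex set: $\mathcal Y$ is $\alpha$-strongly convex if for all $y,y'\in\mathcal Y$, $z\in\mathbb R^{d_y}$ with $\|z\|=1$, $\xi\in[0,1]$: $\xi y+(1-\xi)y'+\xi(1-\xi)\frac{\alpha}{2}\|y-y'\|^2z\in\mathcal Y$. Oracles: $\mathrm{LMO}_{\mathcal U}(d)$ denotes an arbitrary element of $\arg\min_{v\in\mathcal U}d^\top v$; $\mathrm{PO}_{\mathcal U}(u)=\arg\min_{v\in\mathcal U}\|u-v\|^2$ is Euclidean projection. Gaps: $G_{\mathcal Y}(x,y)=\max_{u\in\mathcal Y}\mathcal L(x,u)-\mathcal L(x,y)$ and, for a parameter $\sigma>0$, $G^{\mathrm{PO}}_{\mathcal X}(x,y)=\left\|\frac1\sigma\left(\mathrm{PO}_{\mathcal X}(x-\sigma\nabla_x\mathcal L(x,y))-x\right)\right\|$. Regularized payoff: $\mathcal L_\beta(x,y)=\mathcal L(x,y)-\frac{\beta}{2}\|y-y_0\|^2$, where $y_0\in\mathcal Y$ is the initial dual iterate. PO-LMO algorithm: start from $x_0\in\mathcal X$, $y_0\in\mathcal Y$; for $t=0,1,2,\dots$: $x_{t+1}=\mathrm{PO}_{\mathcal X}(x_t-\tau_t\nabla_x\mathcal L(x_t,y_t))$; $u_t=\mathrm{LMO}_{\mathcal Y}(-\nabla_y\mathcal L_{\beta_t}(x_t,y_t))$,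 $\gamma_t=\min\left\{\frac{\nabla_y\mathcal L_{\beta_t}(x_t,y_t)^\top(u_t-y_t)}{(L_{yy}+\beta_t)\|u_t-y_t\|^2},1\right\}$, $y_{t+1}=y_t+\gamma_t(u_t-y_t)$ (if $u_t=y_t$, then $y_{t+1}=y_t$). *)

(* Defs.v *)
From HB Require Import structures.
From mathcomp Require Import all_boot all_order all_algebra.
From mathcomp Require Import all_classical all_reals all_analysis.

Set Implicit Arguments.
Unset Strict Implicit.
Unset Printing Implicit Defensive.

Import Order.TTheory GRing.Theory Num.Theory.
Import numFieldNormedType.Exports.

Local Open Scope classical_set_scope.
Local Open Scope ring_scope.

Section Euclidean.
Context {R : realType}.

Definition dotv n (u v : 'rV[R]_n) : R := \sum_i u 0 i * v 0 i.

(* The library norm on ['rV[R]_n] is the sup norm: it yields the same topology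
   and the same derivatives, but the Euclidean norm has to be defined. *)
Definition enorm n (v : 'rV[R]_n) : R := Num.sqrt (dotv v v).

Definition argmin (T : Type) (A : set T) (f : T -> R) : set T :=
  [set v | A v /\ forall w, A w -> f v <= f w].

Definition LMO n (A : set 'rV[R]_n) (d : 'rV[R]_n) : set 'rV[R]_n :=
  argmin A (fun v => dotv d v).

(* When [A] is nonempty, closed and convex the set of minimizers is a singleton,
   so that [get] involves no choice. *)
Definition PO n (A : set 'rV[R]_n) (u : 'rV[R]_n) : 'rV[R]_n :=
  get (argmin A (fun v => enorm (u - v) ^+ 2)).

Definition strongly_convex_set n (alpha : R) (A : set 'rV[R]_n) : Prop :=
  forall (y y' z : 'rV[R]_n) (xi : R),
    A y -> A y' -> enorm z = 1 -> 0 <= xi <= 1 ->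
    A (xi *: y + (1 - xi) *: y'
       + (xi * (1 - xi) * (alpha / 2) * enorm (y - y') ^+ 2) *: z).

Definition strongly_concave_on n (mu : R) (A : set 'rV[R]_n)
    (f : 'rV[R]_n -> R) : Prop :=
  forall (y y' : 'rV[R]_n) (xi : R), A y -> A y' -> 0 <= xi <= 1 ->
    xi * f y + (1 - xi) * f y' + mu / 2 * (xi * (1 - xi)) * enorm (y - y') ^+ 2
      <= f (xi *: y + (1 - xi) *: y').

Definition grad n (f : 'rV[R]_n -> R) (x : 'rV[R]_n) : 'rV[R]_n :=
  \row_i 'D_(delta_mx 0 i) f x.

End Euclidean.

Section Problem.
Context {R : realType} {dx dy : nat}.
Implicit Types (L : 'rV[R]_dx * 'rV[R]_dy -> R) (p q : 'rV[R]_dx * 'rV[R]_dy).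
Implicit Types (X : set 'rV[R]_dx) (Y : set 'rV[R]_dy).

Definition grad_x L p : 'rV[R]_dx := grad (fun x => L (x, p.2)) p.1.

Definition grad_y L p : 'rV[R]_dy := grad (fun y => L (p.1, y)) p.2.

Definition continuously_differentiable_on
    (U : set ('rV[R]_dx * 'rV[R]_dy)) L : Prop :=
  forall p, U p ->
    [/\ differentiable L p,
        {for p, continuous (grad_x L)} & {for p, continuous (grad_y L)}].

Record standing_assumption X Y L (mu Lxx Lyy Lyx : R) : Prop := {
  standing_X_nonempty : X !=set0;
  standing_X_compact : compact X;
  standing_X_convex : convex_set X;
  standing_Y_nonempty : Y !=set0;
  standing_Y_compact : compact Y;
  standing_Y_convex : convex_set Y;
  standing_C1 : exists U : set ('rV[R]_dx * 'rV[R]_dy),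
    [/\ open U, X `*` Y `<=` U & continuously_differentiable_on U L];
  standing_mu_ge0 : 0 <= mu;
  standing_concave :
    forall x, X x -> strongly_concave_on mu Y (fun y => L (x, y));
  standing_Lxx_ge0 : 0 <= Lxx;
  standing_Lyy_ge0 : 0 <= Lyy;
  standing_Lyx_gt0 : 0 < Lyx;
  standing_grad_x_lipschitz : forall p q, (X `*` Y) p -> (X `*` Y) q ->
    enorm (grad_x L p - grad_x L q)
      <= Lxx * enorm (p.1 - q.1) + Lyx * enorm (p.2 - q.2);
  standing_grad_y_lipschitz : forall p q, (X `*` Y) p -> (X `*` Y) q ->
    enorm (grad_y L p - grad_y L q)
      <= Lyx * enorm (p.1 - q.1) + Lyy * enorm (p.2 - q.2)
}.

(* The supremum is a maximum when [Y] is compact and [L (x, _)] continuous. *)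
Definition gap_Y Y L (x : 'rV[R]_dx) (y : 'rV[R]_dy) : R :=
  sup [set L (x, u) | u in Y] - L (x, y).

Definition gap_X_PO X L (sigma : R) (x : 'rV[R]_dx) (y : 'rV[R]_dy) : R :=
  enorm (sigma^-1 *: (PO X (x - sigma *: grad_x L (x, y)) - x)).

Definition regularized L (beta : R) (y0 : 'rV[R]_dy) p : R :=
  L p - beta / 2 * enorm (p.2 - y0) ^+ 2.

(* [u] records the oracle answers.  If [u t = y t], the last equation gives
   [y t.+1 = y t] whatever the value of [gamma], so that the convention
   [r / 0 = 0] is harmless there. *)
Record PO_LMO X Y L (Lyy : R) (tau beta : nat -> R)
    (x : nat -> 'rV[R]_dx) (y u : nat -> 'rV[R]_dy) : Prop := {
  PO_LMO_x0 : X (x 0%N);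
  PO_LMO_y0 : Y (y 0%N);
  PO_LMO_x : forall t, x t.+1 = PO X (x t - tau t *: grad_x L (x t, y t));
  PO_LMO_u : forall t,
    LMO Y (- grad_y (regularized L (beta t) (y 0%N)) (x t, y t)) (u t);
  PO_LMO_y : forall t,
    let g := grad_y (regularized L (beta t) (y 0%N)) (x t, y t) in
    let gamma := Num.min
      (dotv g (u t - y t) / ((Lyy + beta t) * enorm (u t - y t) ^+ 2)) 1 in
    y t.+1 = y t + gamma *: (u t - y t)
}.

End Problem.

Section Rates.
Context {R : realType}.
Implicit Types (f tau beta : nat -> R) (a b r : R).

Definition Theta_stepsize tau a : Prop :=
  exists c1 c2 : R, [/\ 0 < c1, c1 <= c2 &
    forall t : nat,
      c1 * t.+1%:R `^ (- a) <= tau t <= c2 * t.+1%:R `^ (- a)].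

Definition decaying_regularization beta b : Prop :=
  exists2 C : R, 0 < C & forall t : nat, beta t = C * t.+1%:R `^ (- b).

Definition average f (T : nat) : R :=
  T.+1%:R^-1 * \sum_(0 <= t < T.+1) f t.

Definition bigO_rate f r : Prop :=
  exists K : R, forall T : nat, (1 <= T)%N -> f T <= K * T%:R `^ r.

(* As [1 < ln 3], a single power of [ln (T + 2)] dominates any polynomial
   in [ln (T + 2)], up to a constant. *)
Definition softO_rate f r : Prop :=
  exists (K : R) (k : nat), forall T : nat, (1 <= T)%N ->
    f T <= K * ln T.+2%:R ^+ k * T%:R `^ r.

End Rates.

(* Main.v *)
Require Import Defs.
From mathcomp Require Import all_boot all_order all_algebra.
From mathcomp Require Import all_classical all_reals all_analysis.
From mathcomp Require Import ring lra zify.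

Set Implicit Arguments.
Unset Strict Implicit.
Unset Printing Implicit Defensive.

Import Order.TTheory GRing.Theory Num.Theory.
Import numFieldNormedType.Exports.

Local Open Scope classical_set_scope.
Local Open Scope ring_scope.

(** Every rate comes from one Lyapunov function.  Write N = t + 1,
    L_t = L - beta_t / 2 |y - y_0|^2 for the regularized payoff,
    G_t = |x_(t+1) - x_t| / tau_t for the primal gap, h_t for the dual gap
    max_Y L_t(x_t, .) - L_t(x_t, y_t), p_t = L_t(x_t, y_(t+1)) - L_t(x_t, y_t)
    for the progress of the dual step, and m_t > 0 for a lower bound of the
    strong concavity modulus mu + beta_t.

    The projection step decreases L by tau_t G_t^2, up to the error
    Lyx |y_(t+1) - y_t| tau_t G_t; since the short step makes
    m_t |y_(t+1) - y_t|^2 at most 2 p_t, this error is paid by the progress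
    ([potential_step]).  Moving x changes the dual gap only through the mixed
    second difference of L between two x and two y, hence by at most
    Lyx w tau_t G_t, where w is the distance from y_(t+1) to the new
    maximizer and strong concavity gives m_(t+1) w^2 <= 4 h_(t+1)
    ([dual_gap_step]).  So for a large constant M the quantity
    L_t(x_t, y_t) + M h_t decreases at each step by a multiple of
    tau_t G_t^2 + p_t, up to the error (tau_t / m_(t+1)) h_(t+1) and to terms
    of order 1 / N ([lyapunov_step]).

    The remaining error is absorbed in the next progress p_(t+1).  On a general
    compact convex Y, p_t dominates h_t^2 ([quadratic_progress]), and Young's
    inequality leaves (tau_t / m_(t+1))^2; on a strongly convex Y, p_t
    dominates (m_t)^(1/2) h_t^(3/2) ([strongly_convex_progress]), and
    what is left is (tau_t / m_(t+1))^3 / m_(t+1).  With tau_t of order N^-a and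
    m_t of order N^-b, both are at most of order 1 / N exactly when
    2 (a - b) >= 1, respectively 3 a - 4 b >= 1, which is what the four choices
    of exponents achieve.

    Summing the resulting inequality directly would cost a logarithm.  Summed
    against the growing weights N^s with s > 0, it gives a bound of order T^s
    without logarithm ([weighted_telescope]), and the averages of G_t and h_t
    follow from the pointwise inequality g <= g^2 / w + w for a suitable power
    w of N, and its analogue for h_t.  All the rates are therefore obtained as
    plain O(.) bounds. *)

(** * The Euclidean inner product and norm *)

Section EuclideanSpace.
Context {R : realType} {n : nat}.
Implicit Types (u v w : 'rV[R]_n) (c : R).

Lemma dotvC u v : dotv u v = dotv v u.
Proof. by apply: eq_bigr => i _; rewrite mulrC. Qed.

Lemma dotvDl u v w : dotv (u + v) w = dotv u w + dotv v w.
Proof. by rewrite -big_split; apply: eq_bigr => i _; rewrite mxE mulrDl. Qed.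

Lemma dotvZl c u v : dotv (c *: u) v = c * dotv u v.
Proof. by rewrite /dotv mulr_sumr; apply: eq_bigr => i _;
  rewrite mxE mulrA. Qed.

Lemma dotvNl u v : dotv (- u) v = - dotv u v.
Proof. by rewrite -scaleN1r dotvZl mulN1r. Qed.

Lemma dotvBl u v w : dotv (u - v) w = dotv u w - dotv v w.
Proof. by rewrite dotvDl dotvNl. Qed.

Lemma dotvDr u v w : dotv w (u + v) = dotv w u + dotv w v.
Proof. by rewrite dotvC dotvDl !(dotvC w). Qed.

Lemma dotvZr c u v : dotv u (c *: v) = c * dotv u v.
Proof. by rewrite dotvC dotvZl dotvC. Qed.

Lemma dotvNr u v : dotv u (- v) = - dotv u v.
Proof. by rewrite dotvC dotvNl dotvC. Qed.

Lemma dotvBr u v w : dotv w (u - v) = dotv w u - dotv w v.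
Proof. by rewrite dotvDr dotvNr. Qed.

Definition dotvE := (dotvDl, dotvDr, dotvNl, dotvNr, dotvZl, dotvZr).

Lemma dotv0l u : dotv 0 u = 0.
Proof. by rewrite -(scale0r u) dotvZl mul0r. Qed.

Lemma dotv_ge0 u : 0 <= dotv u u.
Proof. by apply: sumr_ge0 => i _; rewrite -expr2 sqr_ge0. Qed.

Lemma enorm_ge0 u : 0 <= enorm u.
Proof. exact: sqrtr_ge0. Qed.

Lemma sqr_enorm u : enorm u ^+ 2 = dotv u u.
Proof. by rewrite sqr_sqrtr ?dotv_ge0. Qed.

Lemma sqr_enormD u v :
  enorm (u + v) ^+ 2 = enorm u ^+ 2 + 2 * dotv u v + enorm v ^+ 2.
Proof. by rewrite !sqr_enorm !dotvE (dotvC v u); ring. Qed.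

Lemma enormZ c u : enorm (c *: u) = `|c| * enorm u.
Proof.
by rewrite /enorm dotvZl dotvZr mulrA -expr2 sqrtrM ?sqr_ge0// sqrtr_sqr.
Qed.

Lemma enormZ_ge0 c u : 0 <= c -> enorm (c *: u) = c * enorm u.
Proof. by move=> c0; rewrite enormZ ger0_norm. Qed.

Lemma enormN u : enorm (- u) = enorm u.
Proof. by rewrite -scaleN1r enormZ normrN1 mul1r. Qed.

Lemma enormBC u v : enorm (u - v) = enorm (v - u).
Proof. by rewrite -enormN opprB. Qed.

Lemma enorm0 : enorm (0 : 'rV[R]_n) = 0.
Proof. by rewrite /enorm dotv0l sqrtr0. Qed.

Lemma enorm_eq0 u : enorm u = 0 -> u = 0.
Proof.
move=> u0; have /eqP : dotv u u = 0 by rewrite -sqr_enorm u0 expr0n.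
rewrite psumr_eq0 => [/allP u_eq0|i _]; last by rewrite -expr2 sqr_ge0.
apply/rowP => i; rewrite mxE; apply/eqP.
by have := u_eq0 i (mem_index_enum _); rewrite /= mulf_eq0 orbb.
Qed.

Lemma dotv_le_enorm u v : dotv u v <= enorm u * enorm v.
Proof.
have [u0|u0] := eqVneq (enorm u) 0.
  by rewrite u0 mul0r (enorm_eq0 u0) dotv0l.
have [v0|v0] := eqVneq (enorm v) 0.
  by rewrite v0 mulr0 (enorm_eq0 v0) dotvC dotv0l.
have uv_gt0 : 0 < enorm u * enorm v.
  by rewrite mulr_gt0// lt_neqAle eq_sym ?u0 ?v0 enorm_ge0.
have := dotv_ge0 (enorm v *: u - enorm u *: v).
rewrite !dotvE (dotvC v u) -!sqr_enorm => sq_ge0.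
rewrite -(ler_pM2l uv_gt0); nra.
Qed.

Lemma ler_dotv_enorm c u v : enorm u <= c -> dotv u v <= c * enorm v.
Proof.
by move=> uc; rewrite (le_trans (dotv_le_enorm u v))// ler_wpM2r// enorm_ge0.
Qed.

Lemma ler_Ndotv_enorm c u v : enorm u <= c -> - (c * enorm v) <= dotv u v.
Proof. by move=> uc; rewrite lerNl -dotvNl ler_dotv_enorm// enormN. Qed.

Lemma ler_enormD u v : enorm (u + v) <= enorm u + enorm v.
Proof.
rewrite -ler_sqr ?nnegrE ?addr_ge0 ?enorm_ge0// sqr_enormD sqrrD.
by have := dotv_le_enorm u v; lra.
Qed.

Lemma convex_set_segment (A : set 'rV[R]_n) u v (s : R) :
  convex_set A -> A u -> A v -> 0 <= s <= 1 -> A (u + s *: (v - u)).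
Proof.
move=> cA Au Av /andP[s0 s1].
have := cA v u (Itv01 s0 s1) (mem_set Av) (mem_set Au).
rewrite inE /conv /= /unstable.onem scalerBl scale1r scalerBr => Asegm.
by congr A: Asegm; rewrite addrC -!addrA (addrC (- _)).
Qed.

End EuclideanSpace.

(** * Gradients along segments *)

(** The first-order term of an expansion in s has a sign as soon as it is
    bounded by the second-order one for all small s. *)
Lemma le0_of_ler_small (R : realFieldType) (a b : R) :
  (forall s, 0 < s -> s <= 1 -> a <= s * b) -> a <= 0.
Proof.
move=> ab; apply/ler_addgt0Pr => e e0; rewrite add0r.
have b0 : 0 < e + `|b| by rewrite ltr_pwDl.
have s0 : 0 < e / (e + `|b|) by rewrite divr_gt0.
rewrite (le_trans (ab _ s0 _)) ?ler_pdivrMr ?mul1r ?lerDl//.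
rewrite mulrAC ler_pdivrMr// ler_pM2l//.
by rewrite (le_trans (ler_norm b))// lerDr ltW.
Qed.

Section Gradient.
Context {R : realType} {n : nat}.
Implicit Types (f : 'rV[R]_n -> R) (x v : 'rV[R]_n).

Lemma derive_grad f x v : differentiable f x -> 'D_v f x = dotv (grad f x) v.
Proof.
move=> df; rewrite deriveE// {1}(row_sum_delta v) linear_sum.
by apply: eq_bigr => i _; rewrite mxE deriveE// linearZ mulrC.
Qed.

Lemma gradB f g x : differentiable f x -> differentiable g x ->
  grad (fun z => f z - g z) x = grad f x - grad g x.
Proof.
move=> df dg; apply/rowP => i; rewrite !mxE.
by rewrite [LHS](@deriveB _ _ _ f g)//; exact: diff_derivable.
Qed.

Lemma is_derive_segment f x v (s : R) : differentiable f (x + s *: v) ->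
  is_derive s 1 (fun r => f (x + r *: v)) (dotv (grad f (x + s *: v)) v).
Proof.
move=> df; rewrite -derive_grad//; have dfv := @diff_derivable _ _ _ _ _ v df.
(* Both difference quotients are the same function of the increment. *)
have E : (fun h : R => h^-1 *: (f (x + (h *: (1 : R) + s) *: v) - f (x + s *:
  v)))
       = (fun h : R => h^-1 *: (f (h *: v + (x + s *: v)) - f (x + s *: v))).
  by apply/funext => h; rewrite scaler1 scalerDl addrCA.
by split; rewrite /derivable /derive E.
Qed.

Lemma grad_mean_value f x y :
  (forall s : R, 0 <= s <= 1 -> differentiable f (x + s *: (y - x))) ->
  exists2 s : R, 0 <= s <= 1 &
    f y - f x = dotv (grad f (x + s *: (y - x))) (y - x).
Proof.
move=> df; pose phi (r : R) := f (x + r *: (y - x)).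
pose dphi (r : R) := dotv (grad f (x + r *: (y - x))) (y - x).
have phi' (s : R) : s \in `[0, 1]%R -> is_derive s 1 phi (dphi s).
  by rewrite in_itv => s01; apply: is_derive_segment; exact: df.
have phi_oo (s : R) : s \in `]0, 1[%R -> is_derive s 1 phi (dphi s).
  by move=> /subset_itv_oo_cc; exact: phi'.
have phi_cont : {within `[0, 1], continuous phi}.
  apply: derivable_within_continuous => s /phi' sder; exact: ex_derive.
have [s s01] := MVT_segment ler01 phi_oo phi_cont.
rewrite /phi scale0r addr0 scale1r [x + _]addrC subrK subr0 mulr1 => ->.
by exists s => //; move: s01; rewrite in_itv.
Qed.

Lemma is_derive_sqr_enorm (c x v : 'rV[R]_n) :
  is_derive x v (fun y => enorm (y - c) ^+ 2) (2 * dotv (x - c) v).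
Proof.
have cvgq : h^-1 *: (enorm (h *: v + x - c) ^+ 2 - enorm (x - c) ^+ 2)
    @[h --> (0 : R)^'] --> 2 * dotv (x - c) v.
  have : 2 * dotv (x - c) v + h * dotv v v @[h --> (0 : R)^']
      --> 2 * dotv (x - c) v + 0 * dotv v v.
    apply: cvg_within_filter; apply: cvgD; first exact: cvg_cst.
    by apply: cvgM; [exact: cvg_id|exact: cvg_cst].
  rewrite mul0r addr0; apply: cvg_trans; apply: near_eq_cvg.
  near=> h.
  have h0 : h != 0 by near: h; exact: nbhs_dnbhs_neq.
  (* The increment of the square is 2 h <x - c, v> + h^2 |v|^2. *)
  rewrite -(addrA _ x) (addrC (h *: v)) (sqr_enormD (x - c)) enormZ exprMn
    real_normK ?num_real//.
  by rewrite dotvZr -sqr_enorm [_ *: _]mulrDr; field.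
split; first by apply: cvgP cvgq.
exact: cvg_lim cvgq.
Unshelve. all: by end_near. Qed.

End Gradient.

Section SmoothFunction.
Context {R : realType} {n : nat} (A : set 'rV[R]_n) (f : 'rV[R]_n -> R).
Context (ell : R).
Context (convexA : convex_set A).
Context (diff_f : forall x, A x -> differentiable f x).
Context (lip_f : forall x y, A x -> A y ->
  enorm (grad f x - grad f y) <= ell * enorm (x - y)).

(** The factor 1/2 matters: the short step of the algorithm makes no guaranteed
    progress against the cruder bound without it.  Hence the mean value theorem
    is applied to f along the segment minus its first-order part plus the
    quadratic, a function with nonnegative derivative. *)
Lemma smooth_lower_bound x y : A x -> A y ->
  f x + dotv (grad f x) (y - x) - ell / 2 * enorm (y - x) ^+ 2 <= f y.
Proof.
move=> Ax Ay; set d := y - x.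
pose phi (r : R) := f (x + r *: d) - r * dotv (grad f x) d
  + r ^+ 2 * (ell / 2 * enorm d ^+ 2).
pose dphi (r : R) := dotv (grad f (x + r *: d)) d - dotv (grad f x) d
  + r * (ell * enorm d ^+ 2).
have Ad (s : R) : 0 <= s <= 1 -> A (x + s *: d) by exact: convex_set_segment.
have phi' (s : R) : s \in `[0, 1]%R -> is_derive s 1 phi (dphi s).
  rewrite in_itv => s01.
  have fD := is_derive_segment (diff_f (Ad _ s01)).
  apply: is_derive_eq.
  by rewrite /dphi !scaler0 /GRing.scale /= !mulr1; field.
have phi_oo (s : R) : s \in `]0, 1[%R -> is_derive s 1 phi (dphi s).
  by move=> /subset_itv_oo_cc; exact: phi'.
have phi_cont : {within `[0, 1], continuous phi}.
  apply: derivable_within_continuous => s /phi' sder; exact: ex_derive.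
have [s s01] := MVT_segment ler01 phi_oo phi_cont.
rewrite subr0 mulr1 {1 2}/phi scale0r addr0 scale1r.
rewrite {1}/d (addrC x) subrK -/d expr1n expr0n !mul0r !mul1r subr0 addr0.
move=> phi01; rewrite -subr_ge0.
rewrite [leRHS](_ : _ = dphi s); last by rewrite -phi01; ring.
move: s01; rewrite in_itv => s01; have [s0 _] := andP s01.
have := ler_Ndotv_enorm d (lip_f (Ad _ s01) Ax).
rewrite dotvBl [x + _ - x]addrC addKr enormZ_ge0// /dphi => lb; lra.
Qed.

(** The Lipschitz gradient replaces the passage to the limit in the difference
    quotient: at distance s along the segment the error is of order s. *)
Lemma concave_upper_bound x y : A x -> A y ->
  (forall s : R, 0 <= s <= 1 ->
    s * f y + (1 - s) * f x <= f (s *: y + (1 - s) *: x)) ->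
  f y <= f x + dotv (grad f x) (y - x).
Proof.
move=> Ax Ay concave_f; rewrite -lerBlDl -subr_le0.
set d := y - x.
apply: (@le0_of_ler_small R _ (ell * enorm d ^+ 2)) => s s0 s1.
have s01 : 0 <= s <= 1 by rewrite ltW.
have Ad (r : R) : 0 <= r <= 1 -> A (x + r *: d) by exact: convex_set_segment.
have sdE (r : R) : x + r *: (x + s *: d - x) = x + (r * s) *: d.
  by rewrite (addrC x (s *: d)) addrK scalerA.
have rs01 (r : R) : 0 <= r <= 1 -> 0 <= r * s <= 1.
  by move=> /andP[r0 r1]; rewrite mulr_ge0 ?(ltW s0)// mulr_ile1 ?(ltW s0).
have [|r r01] := @grad_mean_value _ _ f x (x + s *: d).
  by move=> r r01; rewrite sdE; apply/diff_f/Ad/rs01.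
rewrite sdE (addrC x (s *: d)) addrK addrC dotvZr => fs.
have rs0 : 0 <= r * s by have /andP[] := rs01 _ r01.
have ell0 : 0 <= ell * enorm d ^+ 2.
  rewrite expr2 mulrA mulr_ge0 ?enorm_ge0//.
  by rewrite (le_trans _ (lip_f Ay Ax)) ?enorm_ge0.
have := concave_f s s01.
rewrite scalerBl scale1r addrCA -scalerBr -/d => fconc.
have fyx : f y - f x <= dotv (grad f (x + (r * s) *: d)) d.
  rewrite -(ler_pM2l s0) -fs; lra.
have := ler_dotv_enorm d (lip_f (Ad _ (rs01 _ r01)) Ax).
rewrite dotvBl [x + _ - x]addrC addKr enormZ ger0_norm// => ub.
have rs_le : r * s * (ell * enorm d ^+ 2) <= s * (ell * enorm d ^+ 2).
  by rewrite ler_wpM2r// ler_piMl ?(ltW s0)//; have /andP[] := r01.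
lra.
Qed.

End SmoothFunction.

(** * Concave functions with a quadratic regularization *)

Section ConcaveRegularization.
Context {R : realType} {n : nat} (A : set 'rV[R]_n) (f : 'rV[R]_n -> R).
Context (mu ell : R).
Context (convexA : convex_set A).
Context (diff_f : forall x, A x -> differentiable f x).
Context (lip_f : forall x y, A x -> A y ->
  enorm (grad f x - grad f y) <= ell * enorm (x - y)).
Context (mu_ge0 : 0 <= mu).
Context (concave_f : strongly_concave_on mu A f).

(** The smoothness bound from the midpoint to both ends and strong concavity
    at the midpoint squeeze the same second difference.  Consequently the
    smoothness constant in the step size is at least the modulus of strong
    concavity, as soon as the oracle does not return the current point. *)
Lemma concavity_le_smoothness x y : A x -> A y -> x != y -> mu <= ell.
Proof.
move=> Ax Ay xy; set z := x + 2^-1 *: (y - x).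
have Az : A z by apply: convex_set_segment => //; lra.
have zx : x - z = - 2^-1 *: (y - x) by rewrite /z opprD addNKr scaleNr.
have zy : y - z = 2^-1 *: (y - x).
  apply/rowP => i; rewrite !mxE; lra.
have := smooth_lower_bound convexA diff_f lip_f Az Ax.
have := smooth_lower_bound convexA diff_f lip_f Az Ay.
have half_norm : `|2^-1 : R| = 2^-1 by rewrite ger0_norm ?invr_ge0.
rewrite zx zy !enormZ !dotvZr normrN !exprMn half_norm => fy fx.
have h01 : 0 <= (2^-1 : R) <= 1 by lra.
have := concave_f Ay Ax h01.
have -> : 2^-1 *: y + (1 - 2^-1) *: x = z.
  by apply/rowP => i; rewrite !mxE; lra.
move=> fz; have d0 : 0 < enorm (y - x) ^+ 2.
  rewrite exprn_gt0// lt_neqAle enorm_ge0 andbT eq_sym.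
  by apply: contra xy => /eqP/enorm_eq0/subr0_eq ->.
rewrite -(ler_pM2r d0); lra.
Qed.

Context (beta : R) (c : 'rV[R]_n).
Context (beta_ge0 : 0 <= beta).

Let fb y := f y - beta / 2 * enorm (y - c) ^+ 2.

Lemma grad_regularized y : A y -> grad fb y = grad f y - beta *: (y - c).
Proof.
move=> Ay; apply/rowP => i; rewrite !mxE.
have df := derivableP (@diff_derivable _ _ _ _ _ (delta_mx 0 i) (diff_f Ay)).
have dq := is_derive_sqr_enorm c y (delta_mx 0 i).
have dfb : is_derive y (delta_mx 0 i) fb
    ('D_(delta_mx 0 i) f y - beta * dotv (y - c) (delta_mx 0 i)).
  by apply: is_derive_eq; rewrite /GRing.scale /=; field.
rewrite derive_val /dotv (bigD1 i)//= big1 => [|j ji].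
  by rewrite !mxE !eqxx mulr1 addr0.
by rewrite !mxE (negbTE ji) andbF mulr0.
Qed.

Let sqr_dist_expand x y : enorm (y - c) ^+ 2 =
  enorm (x - c) ^+ 2 + 2 * dotv (x - c) (y - x) + enorm (y - x) ^+ 2.
Proof. by rewrite -sqr_enormD [x - c + _]addrC subrKA. Qed.

Lemma regularized_smooth x y : A x -> A y ->
  fb x + dotv (grad fb x) (y - x) - (ell + beta) / 2 * enorm (y - x) ^+ 2
    <= fb y.
Proof.
move=> Ax Ay; have := smooth_lower_bound convexA diff_f lip_f Ax Ay.
by rewrite grad_regularized// /fb dotvBl dotvZl (sqr_dist_expand x y); lra.
Qed.

Lemma regularized_concave x y : A x -> A y ->
  fb y <= fb x + dotv (grad fb x) (y - x).
Proof.
move=> Ax Ay.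
have : f y <= f x + dotv (grad f x) (y - x).
  apply: (concave_upper_bound convexA diff_f lip_f) => // s s01.
  apply: le_trans (concave_f Ay Ax s01); rewrite lerDl.
  by have /andP[s0 s1] := s01; rewrite !mulr_ge0 ?subr_ge0 ?invr_ge0 ?exprn_ge0
    ?enorm_ge0.
rewrite grad_regularized// /fb dotvBl dotvZl (sqr_dist_expand x y).
have : 0 <= beta / 2 * enorm (y - x) ^+ 2.
  by rewrite mulr_ge0 ?divr_ge0// exprn_ge0 ?enorm_ge0.
lra.
Qed.

(** Quadratic growth at the maximizer, read off at the midpoint; the sharp
    constant 2 in place of 4 would need a limit and brings nothing. *)
Lemma regularized_growth m x y : A x -> A y -> m <= mu + beta ->
  (forall z, A z -> fb z <= fb y) ->
  m * enorm (y - x) ^+ 2 <= 4 * (fb y - fb x).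
Proof.
move=> Ax Ay m_le ymax; set z := x + 2^-1 *: (y - x).
have Az : A z by apply: convex_set_segment => //; lra.
have h01 : 0 <= (2^-1 : R) <= 1 by lra.
have := concave_f Ay Ax h01.
have -> : 2^-1 *: y + (1 - 2^-1) *: x = z.
  by apply/rowP => i; rewrite !mxE; lra.
move=> fz; have := ymax _ Az; rewrite /fb.
have -> : enorm (z - c) ^+ 2
    = 2^-1 * enorm (x - c) ^+ 2 + 2^-1 * enorm (y - c) ^+ 2
      - 4^-1 * enorm (y - x) ^+ 2.
  rewrite (sqr_dist_expand x z) (sqr_dist_expand x y).
  rewrite /z [x + _ - x]addrC addKr enormZ dotvZr exprMn.
  by rewrite ger0_norm ?invr_ge0//; field.
have : m * enorm (y - x) ^+ 2 <= (mu + beta) * enorm (y - x) ^+ 2.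
  by rewrite ler_wpM2r// exprn_ge0 ?enorm_ge0.
lra.
Qed.

End ConcaveRegularization.

(** * Compact sets and the Euclidean projection *)

Section CompactSet.
Context {R : realType} {n : nat}.

Lemma continuous_sqr_enorm (u : 'rV[R]_n) :
  continuous (fun v : 'rV[R]_n => enorm (v - u) ^+ 2).
Proof.
under eq_fun do rewrite sqr_enorm /dotv.
apply: continuous_big => [|i _ v]; first exact: add_continuous.
have coord : continuous (fun w : 'rV[R]_n => (w - u) 0 i).
  have -> : (fun w : 'rV[R]_n => (w - u) 0 i) = (fun w => w 0 i - u 0 i).
    by apply/funext => w; rewrite !mxE.
  by move=> w; apply: continuousB; [exact: coord_continuous|exact:
    cst_continuous].
exact: cvgM (coord v) (coord v).
Qed.

Lemma compact_sqr_diameter (A : set 'rV[R]_n) : A !=set0 -> compact A ->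
  exists D : R, forall y y', A y -> A y' -> enorm (y - y') ^+ 2 <= D.
Proof.
move=> A0 cA; have [a Aa] := A0.
have cont : {within A, continuous (fun v => enorm (v - a) ^+ 2)}.
  exact/continuous_subspaceT/continuous_sqr_enorm.
have [v vA vmax] := compact_EVT_max A0 cA cont.
exists (4 * enorm (v - a) ^+ 2) => y y' Ay Ay'.
have := vmax _ (mem_set Ay); have := vmax _ (mem_set Ay').
have := dotv_ge0 ((y - a) + (y' - a)); rewrite -sqr_enorm sqr_enormD => cross.
have -> : y - y' = (y - a) + - (y' - a) by rewrite opprB subrKA.
by rewrite (sqr_enormD (y - a)) enormN dotvNr; lra.
Qed.

End CompactSet.

Section Projection.
Context {R : realType} {n : nat} (A : set 'rV[R]_n).
Context (A_neq0 : A !=set0).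
Context (compactA : compact A).
Context (convexA : convex_set A).

Lemma PO_argmin u : argmin A (fun v => enorm (u - v) ^+ 2) (PO A u).
Proof.
rewrite /PO; apply: getPex.
have cont : {within A, continuous (fun v => enorm (u - v) ^+ 2)}.
  under eq_fun do rewrite enormBC.
  exact/continuous_subspaceT/continuous_sqr_enorm.
have [v vA vmin] := compact_EVT_min A_neq0 compactA cont.
exists v; split; first exact: set_mem.
by move=> w Aw; apply: vmin; exact: mem_set.
Qed.

Lemma PO_in u : A (PO A u).
Proof. by have [] := PO_argmin u. Qed.

(** First-order optimality of the projection, along the segment to v. *)
Lemma PO_variational u v : A v -> dotv (u - PO A u) (v - PO A u) <= 0.
Proof.
move=> Av; have [Ap pmin] := PO_argmin u; set p := PO A u in Ap pmin *.
apply: (@le0_of_ler_small R _ (enorm (v - p) ^+ 2)) => s s0 s1.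
have := pmin _ (convex_set_segment convexA Ap Av _ : A (p + s *: (v - p))).
rewrite (ltW s0) s1 => /(_ isT).
rewrite opprD addrA (sqr_enormD (u - p)) dotvNr dotvZr enormN enormZ exprMn.
rewrite ger0_norm ?(ltW s0)// => hmin.
have sq0 : 0 <= s * enorm (v - p) ^+ 2.
  by rewrite mulr_ge0 ?(ltW s0)// exprn_ge0 ?enorm_ge0.
by rewrite -(ler_pM2l s0); nra.
Qed.

Context (x g : 'rV[R]_n).
Context (Ax : A x).

Lemma PO_step_descent (tau : R) : 0 < tau ->
  dotv g (PO A (x - tau *: g) - x)
    <= - tau^-1 * enorm (PO A (x - tau *: g) - x) ^+ 2.
Proof.
move=> tau0; have := PO_variational (x - tau *: g) Ax.
set p := PO A _.
have -> : x - tau *: g - p = - (p - x) - tau *: g by rewrite opprB addrAC.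
rewrite -[x - p]opprB; move: (p - x) => d.
rewrite !dotvE -sqr_enorm => h.
rewrite -(ler_pM2l tau0) mulNr mulrN mulVKf ?gt_eqF//; lra.
Qed.

Lemma PO_step_le (tau : R) : 0 < tau ->
  enorm (tau^-1 *: (PO A (x - tau *: g) - x)) <= enorm g.
Proof.
move=> tau0; have := PO_step_descent tau0.
rewrite enormZ_ge0 ?invr_ge0 ?(ltW tau0)//; set d := _ - x => descent.
have := dotv_le_enorm (- g) d; rewrite enormN dotvNl => CS.
have [d0|d0] := eqVneq (enorm d) 0; first by rewrite d0 mulr0 enorm_ge0.
have d_gt0 : 0 < enorm d by rewrite lt_neqAle eq_sym d0 enorm_ge0.
by rewrite -(ler_pM2r d_gt0); lra.
Qed.

(** The normalized projection step decreases with the step size: this is how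
    the gap for sigma = tau_0 is bounded by the gap for tau_t <= tau_0, which is
    the one that the algorithm decreases.  With P and Q the two steps, the
    variational inequalities combine into
    (|Q| - |P|) (sigma |Q| - tau |P|) <= 0. *)
Lemma PO_step_monotone (tau sigma : R) : 0 < tau -> tau <= sigma ->
  enorm (sigma^-1 *: (PO A (x - sigma *: g) - x))
    <= enorm (tau^-1 *: (PO A (x - tau *: g) - x)).
Proof.
move=> tau0 tau_sigma; have sigma0 := lt_le_trans tau0 tau_sigma.
have := PO_variational (x - sigma *: g) (PO_in (x - tau *: g)).
have := PO_variational (x - tau *: g) (PO_in (x - sigma *: g)).
move: (PO A (x - sigma *: g)) (PO A (x - tau *: g)) => p q.
rewrite 2?enormZ_ge0 ?invr_ge0 ?(ltW tau0) ?(ltW sigma0)//.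
have dE z w : z - w = (z - x) - (w - x) by rewrite opprB subrKA.
have resE (c : R) z : x - c *: g - z = - (z - x) - c *: g.
  by rewrite opprB addrAC.
rewrite !resE (dE p q) (dE q p); move: (p - x) (q - x) => P Q.
rewrite !dotvE -!sqr_enorm (dotvC Q P) => vq vp.
have := dotv_le_enorm P Q; have := enorm_ge0 P; have := enorm_ge0 Q.
move: vq vp.
move: (dotv P Q) (enorm P) (enorm Q) (dotv g P) (dotv g Q).
move=> PQ nP nQ gP gQ vq vp nQ0 nP0 CS.
rewrite ler_pdivrMl// mulrCA ler_pdivlMl// leNgt; apply/negP => lt_gap.
have sum_le : (nQ - nP) * (sigma * nQ - tau * nP) <= 0.
  have : sigma * nQ ^+ 2 + tau * nP ^+ 2 <= (sigma + tau) * PQ.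
    have := ler_wpM2l (ltW sigma0) vq; have := ler_wpM2l (ltW tau0) vp; lra.
  have := ler_wpM2l (ltW (addr_gt0 sigma0 tau0)) CS; lra.
have nQP : nP <= nQ.
  rewrite leNgt; apply/negP => QP.
  have : 0 < (nQ - nP) * (sigma * nQ - tau * nP).
    by rewrite nmulr_lgt0 ?subr_lt0.
  lra.
have := ler_wpM2l (ltW tau0) nQP; have := ler_wpM2r nQ0 tau_sigma; lra.
Qed.

End Projection.

(** * The linear minimization oracle and the short step *)

Section FrankWolfeStep.
Context {R : realType} {n : nat}.
Implicit Types (A : set 'rV[R]_n) (f : 'rV[R]_n -> R) (g y u : 'rV[R]_n).

Lemma LMO_dot_ge0 A g y u : A y -> LMO A (- g) u -> 0 <= dotv g (u - y).
Proof. by move=> Ay [_ /(_ y Ay)]; rewrite dotvBr !dotvNl; lra. Qed.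

(** The step size maximizes the quadratic lower model of f over [0, 1], so the
    progress is at least half of the linear gain gamma <g, u - y>, and at least
    half of ell |y' - y|^2.  The last conclusion covers both values of the
    minimum in gamma at once: any admissible q is a lower bound of gamma. *)
Lemma short_step f g y u (ell m : R) :
  let gamma :=
    Num.min (dotv g (u - y) / (ell * enorm (u - y) ^+ 2)) 1 in
  let y' := y + gamma *: (u - y) in
  0 <= dotv g (u - y) -> 0 < m -> (u != y -> m <= ell) ->
  f y + dotv g (y' - y) - ell / 2 * enorm (y' - y) ^+ 2 <= f y' ->
  [/\ 0 <= gamma <= 1,
      m * enorm (y' - y) ^+ 2 <= 2 * (f y' - f y) &
      forall q h, 0 <= q <= 1 -> 0 <= h <= dotv g (u - y) ->
        q * (ell * enorm (u - y) ^+ 2) <= dotv g (u - y) ->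
        q * h <= 2 * (f y' - f y)].
Proof.
move=> gamma y' gd_ge0 m0 m_le; rewrite /y' [y + _ - y]addrC addKr.
rewrite dotvZr enormZ exprMn real_normK ?num_real// -/y'.
(* If u = y the step does not move, whatever the value of the quotient. *)
have [uy|uy] := eqVneq u y.
  have d0 : u - y = 0 by rewrite uy subrr.
  rewrite {}/y' {}/gamma d0 dotvC dotv0l enorm0 expr0n !mulr0 invr0 mulr0
    scaler0.
  rewrite !addr0 minEle ler01 subrr mulr0 => _.
  split; [by rewrite lexx ler01|by []|move=> q h q01].
  move=> /andP[h0 h1] _; have -> : h = 0 by lra.
  by rewrite mulr0.
have ell0 : 0 < ell by rewrite (lt_le_trans m0)// m_le.
have D0 : 0 < enorm (u - y) ^+ 2.
  rewrite exprn_gt0// lt_neqAle enorm_ge0 andbT eq_sym.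
  by apply: contra uy => /eqP/enorm_eq0/subr0_eq ->.
have {}m_le : m <= ell by exact: m_le.
have ellD0 : 0 < ell * enorm (u - y) ^+ 2 by rewrite mulr_gt0.
have gamma0 : 0 <= gamma by rewrite le_min ler01 divr_ge0// ltW.
have gamma1 : gamma <= 1 by rewrite ge_min lexx orbT.
have gamma_le : gamma * (ell * enorm (u - y) ^+ 2) <= dotv g (u - y).
  by rewrite -ler_pdivlMr// ge_min lexx.
have gamma_max q : q <= 1 -> q * (ell * enorm (u - y) ^+ 2) <= dotv g (u - y) ->
    q <= gamma by move=> q1 qle; rewrite le_min q1 andbT ler_pdivlMr.
move: (dotv g (u - y)) (enorm (u - y) ^+ 2) gamma_le gd_ge0 D0 ellD0 gamma0
  gamma1 gamma_max.
clearbody y' gamma => a D gamma_le a0 D0 ellD0 gamma0 gamma1 gamma_max fstep.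
have := ler_wpM2l gamma0 gamma_le => gamma_le2.
split; first by rewrite gamma0.
  have := ler_wpM2r (mulr_ge0 (sqr_ge0 gamma) (ltW D0)) m_le; lra.
move=> q h /andP[q0 q1] /andP[h0 ha] /(gamma_max _ q1) q_le.
have := ler_pM q0 h0 q_le ha; lra.
Qed.

(** The midpoint of y and u can be pushed by alpha / 8 |u - y|^2 in the
    direction of g without leaving the set, and u still does better. *)
Lemma strongly_convex_LMO A (alpha : R) g y u :
  strongly_convex_set alpha A -> A y -> LMO A (- g) u ->
  alpha / 4 * enorm (u - y) ^+ 2 * enorm g <= dotv g (u - y).
Proof.
move=> scA Ay LMOu; have [g0|g0] := eqVneq (enorm g) 0.
  by rewrite g0 mulr0; exact: LMO_dot_ge0 LMOu.
have [Au umin] := LMOu.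
have ng : enorm ((enorm g)^-1 *: g) = 1.
  by rewrite enormZ_ge0 ?invr_ge0 ?enorm_ge0// mulVf.
have h01 : 0 <= (2^-1 : R) <= 1 by lra.
have := umin _ (scA _ _ _ _ Au Ay ng h01).
have gg : (enorm g)^-1 * dotv g g = enorm g.
  by rewrite -sqr_enorm expr2 mulKf.
rewrite dotvBr !dotvNl !dotvDr !dotvZr gg; lra.
Qed.

End FrankWolfeStep.

(** * Sums with power weights *)

Section PowerWeights.
Context {R : realType}.
Implicit Types (V e f : nat -> R) (s : R).

(** Bernoulli's inequality (1 - 1/N)^s <= 1 - s/N with N = n + 1, deduced from
    Young's inequality with exponents 1/s and 1/(1 - s).  It makes N^(s-1)
    telescope against N^s. *)
Lemma powR_increment s (n : nat) : 0 < s -> s <= 1 ->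
  s * n.+1%:R `^ (s - 1) <= n.+1%:R `^ s - n%:R `^ s.
Proof.
move=> s0 s1; have N0 : 0 < n.+1%:R :> R by rewrite ltr0n.
move: s1; rewrite le_eqVlt => /predU1P[->|s1].
  by rewrite subrr powRr0 !powRr1 ?ler0n// mulr1 -natr1 addrAC subrr add0r.
pose z : R := n%:R / n.+1%:R.
have z0 : 0 <= z by rewrite divr_ge0.
have zs : z `^ s <= s * z + (1 - s).
  have := @conjugate_powR R (z `^ s) 1 s^-1 (1 - s)^-1 (powR_ge0 _ _) ler01.
  rewrite !invr_gt0 subr_gt0 !invrK mulr1 -powRrM mulfV ?gt_eqF// powRr1//.
  by rewrite powR1 mul1r (mulrC z) addrC subrK => /(_ s0 s1 erefl).
have -> : n%:R = n.+1%:R * z :> R by rewrite /z mulrCA mulfV ?gt_eqF ?mulr1.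
rewrite powRM ?ler0n// powRB ?pnatr_eq0 ?implybT// powRr1 ?ler0n//.
have := ler_wpM2l (powR_ge0 (n.+1%:R : R) s) zs.
have zE : z = 1 - n.+1%:R^-1.
  by rewrite /z -[n%:R](addrK 1) natr1 mulrBl mul1r mulfV ?gt_eqF.
move: (z `^ s) => zs'; rewrite zE.
move: (n.+1%:R `^ s) (n.+1%:R^-1) => w i; lra.
Qed.

(** The weights N^s turn the error C / N into N^(s-1), whose sum is of order
    T^s: this is what removes the logarithm of the unweighted sum.  Abel
    summation of the V_t is hidden in the induction, where - V_T T^s carries
    the boundary term. *)
Lemma weighted_telescope V e (B C s : R) : 0 < s -> s <= 1 -> 0 <= C ->
  (forall t, 0 <= V t <= B) ->
  (forall t, V t.+1 + e t <= V t + C / t.+1%:R) ->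
  forall T, \sum_(0 <= t < T) t.+1%:R `^ s * e t <= (B + C / s) * T%:R `^ s.
Proof.
move=> s0 s1 C0 V_bnd V_step T.
suff: \sum_(0 <= t < T) t.+1%:R `^ s * e t
    <= (B + C / s) * T%:R `^ s - V T * T%:R `^ s.
  have /andP[V0 _] := V_bnd T.
  by have := mulr_ge0 V0 (powR_ge0 T%:R s); lra.
elim: T => [|T IH]; first by rewrite big_nil powR0 ?gt_eqF// !mulr0 subrr.
rewrite big_nat_recr//=.
have N0 : 0 < T.+1%:R :> R by rewrite ltr0n.
have inc := powR_increment T s0 s1.
have /andP[V0 VB] := V_bnd T.
have w0 : 0 <= T.+1%:R `^ (s - 1) :> R by exact: powR_ge0.
have dw0 : 0 <= T.+1%:R `^ s - T%:R `^ s :> R by nra.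
have := ler_wpM2l (powR_ge0 (T.+1%:R : R) s) (V_step T).
have -> : T.+1%:R `^ s * (V T + C / T.+1%:R)
    = T.+1%:R `^ s * V T + C * T.+1%:R `^ (s - 1) :> R.
  by rewrite powRB ?pnatr_eq0 ?implybT// powRr1 ?ler0n// mulrDr; ring.
have := ler_wpM2r dw0 VB.
have := ler_wpM2l (divr_ge0 C0 (ltW s0)) inc.
have -> : C / s * (s * T.+1%:R `^ (s - 1)) = C * T.+1%:R `^ (s - 1) :> R.
  by rewrite mulrA divfK ?gt_eqF.
lra.
Qed.

(** The form in which the descent inequality is used: a quantity bounded
    pointwise by N^s e_t, up to N^(s-1), has average of order T^(s-1). *)
Lemma telescope_average_rate V e f (B C K1 K2 s : R) :
  0 < s -> s <= 1 -> 0 <= C -> 0 <= K1 -> 0 <= K2 ->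
  (forall t, 0 <= V t <= B) ->
  (forall t, V t.+1 + e t <= V t + C / t.+1%:R) ->
  (forall t, f t <= K1 * (t.+1%:R `^ s * e t) + K2 * t.+1%:R `^ (s - 1)) ->
  bigO_rate (average f) (s - 1).
Proof.
move=> s0 s1 C0 K10 K20 V_bnd V_step f_le.
have w_sum T : \sum_(0 <= t < T) t.+1%:R `^ (s - 1) <= s^-1 * T%:R `^ s :> R.
  (* The case V = 0 and e_t = 1 / N of the weighted sum. *)
  have zero_bnd (t : nat) : 0 <= (0 : R) <= 0 by rewrite lexx.
  have step (t : nat) : 0 + t.+1%:R^-1 <= 0 + 1 / t.+1%:R :> R by rewrite div1r.
  have := weighted_telescope s0 s1 ler01 zero_bnd step T.
  rewrite add0r div1r; apply: le_trans; rewrite le_eqVlt; apply/orP; left.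
  apply/eqP/eq_bigr => t _.
  by rewrite powRB ?pnatr_eq0 ?implybT// powRr1 ?ler0n.
have B0 : 0 <= B by have /andP[/le_trans] := V_bnd 0%N; apply.
pose K := K1 * (B + C / s) + K2 / s.
have K0 : 0 <= K by rewrite addr_ge0 ?mulr_ge0 ?addr_ge0 ?divr_ge0 ?invr_ge0 //
  ltW.
exists K => T T1.
have T0 : 0 < T%:R :> R by rewrite ltr0n.
have N0 : 0 < T.+1%:R :> R by rewrite ltr0n.
apply: (@le_trans _ _ (K * T.+1%:R `^ (s - 1))); last first.
  rewrite ler_wpM2l// -[s - 1]opprB !powRN lef_pV2 ?posrE ?powR_gt0//.
  by rewrite ge0_ler_powR ?subr_ge0 ?nnegrE ?ler_nat.
rewrite /average powRB ?pnatr_eq0 ?implybT// powRr1 ?ler0n// mulrA mulrC.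
rewrite ler_wpM2r ?invr_ge0 ?ler0n//.
apply: (le_trans (ler_sum _ (fun t _ => f_le t))).
rewrite big_split/= -!mulr_sumr.
have := ler_wpM2l K10 (weighted_telescope s0 s1 C0 V_bnd V_step T.+1).
have := ler_wpM2l K20 (w_sum T.+1); rewrite /K; lra.
Qed.

Lemma bigO_softO f (r : R) : bigO_rate f r -> softO_rate f r.
Proof.
by move=> [K fK]; exists K, 0%N => T T1; rewrite expr0 mulr1; exact: fK.
Qed.

End PowerWeights.

Section PowerEstimates.
Context {R : realType}.
Implicit Types (b z : R).

Lemma powR_exprn (N z : R) n : (N `^ z) ^+ n = N `^ (z * n%:R).
Proof. by rewrite powRrM powR_mulrn// powR_ge0. Qed.

(** Since b <= 1, the ratio z of two consecutive integers satisfies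
    z <= z^b. *)
Lemma powR_succ b (t : nat) : 0 <= b -> b <= 1 ->
  t.+1%:R `^ (- b) * (t.+1%:R / t.+2%:R) <= t.+2%:R `^ (- b).
Proof.
move=> b0 b1; set z : R := _ / _.
have z0 : 0 < z by rewrite divr_gt0.
have z1 : z <= 1 by rewrite ler_pdivrMr// mul1r ler_nat.
have zb : z <= z `^ b by rewrite ger1_powR ?z0.
have -> : t.+2%:R `^ (- b) = t.+1%:R `^ (- b) * z `^ b.
  have -> : t.+1%:R = t.+2%:R * z :> R by rewrite mulrCA mulfV ?mulr1.
  by rewrite !powRN powRM ?(ltW z0)// invfM mulfVK// gt_eqF ?powR_gt0.
by rewrite ler_wpM2l ?powR_ge0.
Qed.

Lemma powR_succ_half b (t : nat) : 0 <= b -> b <= 1 ->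
  t.+1%:R `^ (- b) <= 2 * t.+2%:R `^ (- b) :> R.
Proof.
move=> b0 b1; have := powR_succ t b0 b1.
have : 2^-1 <= t.+1%:R / t.+2%:R :> R.
  rewrite ler_pdivlMr// ler_pdivrMl//; rewrite -natrM ler_nat; lia.
move=> /(ler_wpM2l (powR_ge0 (t.+1%:R : R) (- b))).
by move: (t.+1%:R / t.+2%:R) => r; lra.
Qed.

Lemma powR_decrement b (t : nat) : 0 <= b -> b <= 1 ->
  t.+1%:R `^ (- b) - t.+2%:R `^ (- b) <= 1 / t.+1%:R :> R.
Proof.
move=> b0 b1; have := powR_succ t b0 b1.
have -> : t.+1%:R / t.+2%:R = 1 - t.+2%:R^-1 :> R.
  rewrite -[t.+1%:R](addrK 1) natr1 mulrBl mul1r mulfV//.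
have pow_le1 : t.+1%:R `^ (- b) <= 1 :> R.
  have N1 : 1 <= t.+1%:R :> R by rewrite ler1n.
  by have := ler_powR N1 (_ : - b <= 0); rewrite powRr0 oppr_le0; exact.
have inv_le : t.+2%:R^-1 <= 1 / t.+1%:R :> R by rewrite div1r lef_pV2 ?posrE
  ?ler_nat.
have : t.+1%:R `^ (- b) * t.+2%:R^-1 <= 1 * t.+2%:R^-1 :> R.
  by rewrite ler_wpM2r ?invr_ge0.
by move: inv_le; move: (t.+2%:R^-1) (1 / t.+1%:R) => i j; lra.
Qed.

Lemma powR_le_inv z (t : nat) : z <= -1 -> t.+1%:R `^ z <= t.+1%:R^-1 :> R.
Proof. by move=> z1; rewrite -powR_inv1 ?ler0n// ler_powR ?ler1n. Qed.

End PowerEstimates.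

(** * The Lyapunov function *)

Section Lyapunov.
Context {R : realType}.

(** The three products of the errors with tau G are each split by Young's
    inequality, 1/8 of tau G^2 going to the left-hand side.  The constant M
    is chosen so that the gain M p of the dual gap pays for the growth p of the
    potential, for the error in e, and leaves 2 p. *)
Lemma lyapunov_step (Lxx Lyx C0 tau m m' G e w p h h' Psi Psi' delta : R) :
  let M := 3 + 4 * Lyx ^+ 2 * C0 in
  0 <= C0 -> 0 < tau -> 0 < m' -> tau <= C0 * m ->
  m * e ^+ 2 <= 2 * p -> m' * w ^+ 2 <= 4 * h' ->
  Psi' <= Psi - tau * G ^+ 2
    + (Lxx * (tau * G) + Lyx * e) * (tau * G) + p + delta ->
  h' <= h - p + Lyx * w * (tau * G) + delta ->
  Psi' + M * h' + (tau * G ^+ 2 / 2 + p) <=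
    Psi + M * h - p + 8 * M ^+ 2 * Lyx ^+ 2 * (tau / m' * h')
    + 2 * Lxx ^+ 2 * (tau ^+ 3 * G ^+ 2) + (1 + M) * delta.
Proof.
move=> M C00 tau0 m'0 tau_m e_le w_le Psi_le h_le.
have M0 : 0 <= M by have := mulr_ge0 (sqr_ge0 Lyx) C00; rewrite /M; lra.
have youngE : Lyx * e * (tau * G)
    <= tau * G ^+ 2 / 8 + 2 * Lyx ^+ 2 * (tau * e ^+ 2).
  have := mulr_ge0 (ltW tau0) (sqr_ge0 (G - 4 * Lyx * e)); lra.
have tau_e : tau * e ^+ 2 <= 2 * C0 * p.
  apply: (le_trans (ler_wpM2r (sqr_ge0 e) tau_m)).
  by have := ler_wpM2l C00 e_le; lra.
have youngM : M * (Lyx * w * (tau * G))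
    <= tau * G ^+ 2 / 8 + 2 * M ^+ 2 * Lyx ^+ 2 * (tau * w ^+ 2).
  have := mulr_ge0 (ltW tau0) (sqr_ge0 (G - 4 * M * Lyx * w)); lra.
have tau_w : tau * w ^+ 2 <= 4 * (tau / m' * h').
  have -> : tau * w ^+ 2 = tau / m' * (m' * w ^+ 2).
    by rewrite mulrA divfK ?gt_eqF.
  by rewrite [leRHS]mulrCA ler_wpM2l// divr_ge0 ?(ltW tau0) ?(ltW m'0).
have youngX : Lxx * (tau * G) * (tau * G)
    <= tau * G ^+ 2 / 8 + 2 * Lxx ^+ 2 * (tau ^+ 3 * G ^+ 2).
  have := mulr_ge0 (mulr_ge0 (ltW tau0) (sqr_ge0 G)) (sqr_ge0 (1 - 4 * Lxx *
    tau)).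
  lra.
have L2 : 0 <= 2 * Lyx ^+ 2 by have := sqr_ge0 Lyx; lra.
have ML2 : 0 <= 2 * M ^+ 2 * Lyx ^+ 2 by have := mulr_ge0 (sqr_ge0 M) (sqr_ge0
  Lyx); lra.
have := ler_wpM2l L2 tau_e; have := ler_wpM2l ML2 tau_w.
have := ler_wpM2l M0 h_le.
have MG0 := mulr_ge0 (ltW tau0) (sqr_ge0 G).
move: M0 youngM; rewrite /M; lra.
Qed.

(** The error (tau_t / m_(t+1)) h_(t+1) lives at time t + 1, so it can only be
    compensated by the progress made at the next step.  This is why p_t is
    subtracted from the potential and enters the sum with coefficient 1
    instead of 2. *)
Lemma lyapunov_sequence (Lxx Lyx C0 C1 C2 H B BP : R)
    (tau m G e w p h Psi delta : nat -> R) :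
  0 <= C0 -> 0 <= C1 -> 0 <= C2 ->
  (forall t, 0 < tau t) -> (forall t, 0 < m t) ->
  (forall t, tau t <= C0 * m t) ->
  (forall t, tau t ^+ 3 <= C1 / t.+1%:R) ->
  (forall t, delta t <= C2 / t.+1%:R) ->
  (forall t, 0 <= p t <= h t) -> (forall t, h t <= H) ->
  (forall t, 0 <= G t <= B) -> (forall t, `|Psi t| <= BP) ->
  (forall t, m t * e t ^+ 2 <= 2 * p t) ->
  (forall t, m t.+1 * w t ^+ 2 <= 4 * h t.+1) ->
  (forall t, Psi t.+1 <= Psi t - tau t * G t ^+ 2
    + (Lxx * (tau t * G t) + Lyx * e t) * (tau t * G t) + p t + delta t) ->
  (forall t, h t.+1 <= h t - p t + Lyx * w t * (tau t * G t) + delta t) ->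
  (forall k, 0 < k -> exists2 E, 0 <= E & forall t,
    tau t / m t.+1 * h t.+1 <= k * p t.+1 + E / t.+1%:R) ->
  exists (V : nat -> R) (BV C : R),
    [/\ 0 <= C, forall t, 0 <= V t <= BV &
        forall t, V t.+1 + (tau t * G t ^+ 2 / 2 + p t) <= V t + C / t.+1%:R].
Proof.
move=> C00 C10 C20 tau0 m0 tau_m tau3 delta_le p_h h_H G_B Psi_BP e_le w_le.
move=> Psi_le h_le young.
pose M := 3 + 4 * Lyx ^+ 2 * C0; pose K := 8 * M ^+ 2 * Lyx ^+ 2.
have M3 : 3 <= M by have := mulr_ge0 (sqr_ge0 Lyx) C00; rewrite /M; lra.
have K0 : 0 <= K by have := mulr_ge0 (sqr_ge0 M) (sqr_ge0 Lyx); rewrite /K; lra.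
have [|E E0 {}young] := young (K + 1)^-1; first by rewrite invr_gt0 ltr_wpDl.
have iN0 t : 0 <= t.+1%:R^-1 :> R by rewrite invr_ge0.
pose C := K * E + 2 * Lxx ^+ 2 * (C1 * B ^+ 2) + (1 + M) * C2.
have M0 : 0 <= 1 + M by lra.
exists (fun t => Psi t + BP + M * h t - p t), (2 * BP + M * H), C; split.
- have := mulr_ge0 (sqr_ge0 Lxx) (mulr_ge0 C10 (sqr_ge0 B)).
  by have := mulr_ge0 K0 E0; have := mulr_ge0 M0 C20; rewrite /C; lra.
- move=> t; have /andP[p0 ph] := p_h t; have := Psi_BP t.
  rewrite ler_norml => /andP[Psi1 Psi2].
  have M0' : 0 <= M by lra.
  have := ler_wpM2l M0' (h_H t); have := ler_wpM2r (le_trans p0 ph) M3.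
  by move=> h3 hMH; apply/andP; split; lra.
- move=> t.
  have := lyapunov_step C00 (tau0 t) (m0 t.+1) (tau_m t) (e_le t) (w_le t)
    (Psi_le t) (h_le t).
  rewrite -/M -/K => step.
  have young_t : K * (tau t / m t.+1 * h t.+1) <= p t.+1 + K * E / t.+1%:R.
    apply: (le_trans (ler_wpM2l K0 (young t))).
    rewrite mulrDr !mulrA lerD2r ler_piMl//; first by have /andP[] := p_h t.+1.
    by rewrite ler_pdivrMr ?ltr_wpDl// mul1r lerDl.
  have tau3_t : tau t ^+ 3 * G t ^+ 2 <= C1 * B ^+ 2 / t.+1%:R.
    have /andP[G0 GB] := G_B t.
    have G2 : G t ^+ 2 <= B ^+ 2 by rewrite ler_sqr ?nnegrE// (le_trans G0).
    have t3 : 0 <= tau t ^+ 3 by rewrite exprn_ge0 ?(ltW (tau0 t)).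
    by rewrite [leRHS]mulrAC (ler_pM t3 (sqr_ge0 (G t)) (tau3 t) G2).
  have L2 : 0 <= 2 * Lxx ^+ 2 by have := sqr_ge0 Lxx; lra.
  have := ler_wpM2l L2 tau3_t; have := ler_wpM2l M0 (delta_le t).
  by move: young_t; rewrite /C /=; move: (t.+1%:R^-1) => iN; lra.
Qed.

Lemma young_quadratic (a k h : R) : 0 < k -> a * h <= k * h ^+ 2 + a ^+ 2 / k.
Proof.
move=> k0; have -> : k * h ^+ 2 + a ^+ 2 / k
    = a * h + (k * (h - a / k / 2) ^+ 2 + 3 / 4 * a ^+ 2 / k).
  by field; rewrite gt_eqF.
have := divr_ge0 (sqr_ge0 a) (ltW k0).
have := mulr_ge0 (ltW k0) (sqr_ge0 (h - a / k / 2)); lra.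
Qed.

(** Young's inequality for the exponents 3/2 and 3, in the variable h. *)
Lemma young_three_halves (a k m h : R) : 0 <= a -> 0 < k -> 0 < m -> 0 <= h ->
  a * h <= k * (Num.sqrt (m * h) * h) + a ^+ 3 / (k ^+ 2 * m).
Proof.
move=> a0 k0 m0 h0; set r := Num.sqrt _.
have r0 : 0 <= r by exact: sqrtr_ge0.
have r2 : r ^+ 2 = m * h by rewrite sqr_sqrtr// mulr_ge0 ?(ltW m0).
have km0 : 0 < k ^+ 2 * m by exact: mulr_gt0 (exprn_gt0 2 k0) m0.
have [ar|ra] := leP a (k * r).
  have := divr_ge0 (exprn_ge0 3 a0) (ltW km0); have := ler_wpM2r h0 ar; lra.
have kr0 := mulr_ge0 (ltW k0) r0.
have kr2 : (k * r) ^+ 2 <= a ^+ 2 by rewrite ler_sqr ?nnegrE// ltW.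
have ah : a * h <= a ^+ 3 / (k ^+ 2 * m).
  rewrite ler_pdivlMr//; have := ler_wpM2l a0 kr2; rewrite exprMn r2; lra.
have := mulr_ge0 kr0 h0; lra.
Qed.

End Lyapunov.

(** * The payoff on the product of the two sets *)

Definition dual_argmax {R : realType} dx dy (Y : set 'rV[R]_dy)
    (L : 'rV[R]_dx * 'rV[R]_dy -> R) (x : 'rV[R]_dx) : 'rV[R]_dy :=
  get [set v | Y v /\ forall z, Y z -> L (x, z) <= L (x, v)].

Section PayoffOnProduct.
Context {R : realType} {dx dy : nat} (X : set 'rV[R]_dx) (Y : set 'rV[R]_dy)
  (L : 'rV[R]_dx * 'rV[R]_dy -> R) (mu Lxx Lyy Lyx : R).
Context (SA : standing_assumption X Y L mu Lxx Lyy Lyx).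

Let X0 := standing_X_nonempty SA.
Let cX := standing_X_compact SA.
Let convX := standing_X_convex SA.
Let Y0 := standing_Y_nonempty SA.
Let cY := standing_Y_compact SA.
Let convY := standing_Y_convex SA.

Lemma payoff_differentiable p : (X `*` Y) p -> differentiable L p.
Proof. by have [U [_ XYU dL]] := standing_C1 SA => /XYU/dL[]. Qed.

Lemma payoff_differentiable_x a b : X a -> Y b ->
  differentiable (fun z => L (z, b)) a.
Proof.
move=> Xa Yb; apply: (@differentiable_comp _ _ _ _ (fun z => (z, b)) L).
  exact: differentiable_pair.
exact: payoff_differentiable.
Qed.

Lemma payoff_differentiable_y a b : X a -> Y b ->
  differentiable (fun z => L (a, z)) b.
Proof.
move=> Xa Yb; apply: (@differentiable_comp _ _ _ _ (fun z => (a, z)) L).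
  exact: differentiable_pair.
exact: payoff_differentiable.
Qed.

Lemma payoff_lipschitz_y a : X a -> forall b b', Y b -> Y b' ->
  enorm (grad (fun z => L (a, z)) b - grad (fun z => L (a, z)) b')
    <= Lyy * enorm (b - b').
Proof.
move=> Xa b b' Yb Yb'.
have := standing_grad_y_lipschitz SA (p := (a, b)) (q := (a, b'))
  (conj Xa Yb) (conj Xa Yb').
by rewrite /= subrr enorm0 mulr0 add0r.
Qed.

Lemma payoff_bounded : exists B : R, forall p, (X `*` Y) p -> `|L p| <= B.
Proof.
have XY0 : X `*` Y !=set0.
  by have [a Xa] := X0; have [b Yb] := Y0; exists (a, b).
have cXY : compact (X `*` Y) by exact: compact_setX.
have cont : {within X `*` Y, continuous L}.
  apply: continuous_in_subspaceT => p /set_mem/payoff_differentiable.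
  exact: differentiable_continuous.
have [p _ pmax] := compact_EVT_max XY0 cXY cont.
have [q _ qmin] := compact_EVT_min XY0 cXY cont.
exists (`|L p| + `|L q|) => z /mem_set XYz.
have := pmax _ XYz; have := qmin _ XYz.
have := ler_norm (L p); have := ler_norm (- L q); rewrite normrN.
have := normr_ge0 (L p); have := normr_ge0 (L q).
by rewrite ler_norml => *; apply/andP; split; lra.
Qed.

Lemma grad_x_bounded : exists2 B : R, 0 <= B &
  forall a b, X a -> Y b -> enorm (grad_x L (a, b)) <= B.
Proof.
have [a0 Xa0] := X0; have [b0 Yb0] := Y0.
have [DX DX_le] := compact_sqr_diameter X0 cX.
have [DY DY_le] := compact_sqr_diameter Y0 cY.
have sqrt_bnd (D z : R) : 0 <= z -> z ^+ 2 <= D -> z <= D + 1.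
  by move=> z0 zD; nra.
have DX0 : 0 <= DX by rewrite (le_trans _ (DX_le _ _ Xa0 Xa0)) ?sqr_ge0.
have DY0 : 0 <= DY by rewrite (le_trans _ (DY_le _ _ Yb0 Yb0)) ?sqr_ge0.
exists (enorm (grad_x L (a0, b0)) + (Lxx * (DX + 1) + Lyx * (DY + 1))).
  rewrite !addr_ge0 ?mulr_ge0 ?enorm_ge0 ?addr_ge0//.
    exact: standing_Lxx_ge0 SA.
  exact/ltW/(standing_Lyx_gt0 SA).
move=> a b Xa Yb; rewrite -[grad_x L (a, b)](subrKC (grad_x L (a0, b0))).
apply: (le_trans (ler_enormD _ _)); rewrite lerD2l.
apply: (le_trans (standing_grad_x_lipschitz SA (p := (a, b)) (q := (a0, b0))
  (conj Xa Yb) (conj Xa0 Yb0))).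
apply: lerD; rewrite ler_wpM2l ?(standing_Lxx_ge0 SA)//.
- by apply: sqrt_bnd (enorm_ge0 _) _; exact: DX_le.
- exact/ltW/(standing_Lyx_gt0 SA).
- by apply: sqrt_bnd (enorm_ge0 _) _; exact: DY_le.
Qed.

Context (beta : R) (y0 : 'rV[R]_dy).

Lemma dual_argmaxP a : X a ->
  let v := dual_argmax Y (regularized L beta y0) a in
  Y v /\ forall z, Y z ->
    regularized L beta y0 (a, z) <= regularized L beta y0 (a, v).
Proof.
move=> Xa v; apply: (getPex (P := [set v | Y v /\ _])).
have cont : {within Y, continuous (fun z => regularized L beta y0 (a, z))}.
  apply: continuous_in_subspaceT => z /set_mem Yz.
  rewrite /regularized /=.
  apply: (@continuousB _ _ _ (fun z => L (a, z))
                             (fun z => beta / 2 * enorm (z - y0) ^+ 2)).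
    exact/differentiable_continuous/payoff_differentiable_y.
  apply: continuousM; [exact: cst_continuous|exact: continuous_sqr_enorm].
have [z zY zmax] := compact_EVT_max Y0 cY cont.
exists z; split; first exact: set_mem.
by move=> w Yw; apply: zmax; exact: mem_set.
Qed.

End PayoffOnProduct.

(** * Step inequalities along a run *)

(** The lower bound m of the strong concavity moduli is a parameter because it
    is mu in the strongly concave cases and beta_t in the others. *)
Section Run.
Context {R : realType} {dx dy : nat} (X : set 'rV[R]_dx) (Y : set 'rV[R]_dy)
  (L : 'rV[R]_dx * 'rV[R]_dy -> R) (mu Lxx Lyy Lyx : R) (tau beta : nat -> R)
  (x : nat -> 'rV[R]_dx) (y u : nat -> 'rV[R]_dy).
Context (SA : standing_assumption X Y L mu Lxx Lyy Lyx).
Context (tau_gt0 : forall t, 0 < tau t) (tau_noninc : nonincreasing_seq tau).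
Context (alg : PO_LMO X Y L Lyy tau beta x y u).
Context (m : nat -> R) (m_gt0 : forall t, 0 < m t)
  (m_le : forall t, m t <= mu + beta t).
Context (beta_ge0 : forall t, 0 <= beta t)
  (beta_noninc : forall t, beta t.+1 <= beta t).

Local Notation Lb t := (regularized L (beta t) (y 0%N)).
Local Notation ymax t := (dual_argmax Y (Lb t) (x t)).
Local Notation gapD t := (Lb t (x t, ymax t) - Lb t (x t, y t)).
Local Notation prog t := (Lb t (x t, y t.+1) - Lb t (x t, y t)).
Local Notation G t := (gap_X_PO X L (tau t) (x t) (y t)).

Let X0 := standing_X_nonempty SA.
Let cX := standing_X_compact SA.
Let convX := standing_X_convex SA.
Let Y0 := standing_Y_nonempty SA.
Let cY := standing_Y_compact SA.
Let convY := standing_Y_convex SA.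

Lemma iterate_x_in t : X (x t).
Proof.
case: t => [|t]; first exact: PO_LMO_x0 alg.
by rewrite (PO_LMO_x alg); exact: PO_in.
Qed.

Let diff_y t := fun b Yb => payoff_differentiable_y SA (iterate_x_in t) (b :=
  b) Yb.
Let lip_y t := payoff_lipschitz_y SA (iterate_x_in t).
Let conc_y t := standing_concave SA (iterate_x_in t).

Let grad_b t := grad_y (Lb t) (x t, y t).

Lemma direction_ge0 t : Y (y t) -> 0 <= dotv (grad_b t) (u t - y t).
Proof. by move=> Yy; apply: LMO_dot_ge0 Yy (PO_LMO_u alg t). Qed.

Lemma modulus_le_smoothness t : Y (y t) -> u t != y t -> m t <= Lyy + beta t.
Proof.
move=> Yy uy; apply: (le_trans (m_le t)); rewrite lerD2r.
have [Yu _] := PO_LMO_u alg t.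
exact: (concavity_le_smoothness convY (@diff_y t) (@lip_y t) (@conc_y t)) Yu Yy
  uy.
Qed.

Lemma iterate_step_in t : Y (y t) -> Y (y t.+1).
Proof.
move=> Yy; rewrite (PO_LMO_y alg) /=; set g := Num.min _ _.
have [Yu _] := PO_LMO_u alg t.
apply: convex_set_segment => //; rewrite /g.
rewrite le_min ler01 ge_min lexx orbT !andbT.
rewrite divr_ge0 ?direction_ge0//.
have [->|uy] := eqVneq (u t) (y t); first by rewrite subrr enorm0 expr0n mulr0.
rewrite mulr_ge0 ?exprn_ge0 ?enorm_ge0//.
exact: le_trans (ltW (m_gt0 t)) (modulus_le_smoothness Yy uy).
Qed.

Lemma iterate_y_in t : Y (y t).
Proof.
by elim: t => [|t]; [exact: PO_LMO_y0 alg|exact: iterate_step_in].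
Qed.

Lemma dual_step t :
  m t * enorm (y t.+1 - y t) ^+ 2 <= 2 * prog t /\
  forall q h, 0 <= q <= 1 -> 0 <= h <= dotv (grad_b t) (u t - y t) ->
    q * ((Lyy + beta t) * enorm (u t - y t) ^+ 2)
      <= dotv (grad_b t) (u t - y t) ->
    q * h <= 2 * prog t.
Proof.
have Yy := iterate_y_in t; have Yy' := iterate_y_in t.+1.
have smooth := regularized_smooth convY (@diff_y t) (@lip_y t) (beta t) (y 0%N)
  Yy Yy'.
have [|_ ? ?] := @short_step _ _ (fun z => Lb t (x t, z)) (grad_b t) (y t) (u t)
  (Lyy + beta t) (m t) (direction_ge0 Yy) (m_gt0 t) (modulus_le_smoothness Yy).
  by move: smooth; rewrite (PO_LMO_y alg t).
by rewrite (PO_LMO_y alg t).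
Qed.

Lemma ymax_in t : Y (ymax t).
Proof. by have [] := dual_argmaxP SA (beta t) (y 0%N) (iterate_x_in t). Qed.

Lemma ymax_max t z : Y z -> Lb t (x t, z) <= Lb t (x t, ymax t).
Proof.
by have [_] := dual_argmaxP SA (beta t) (y 0%N) (iterate_x_in t); exact.
Qed.

Lemma ymax_growth t z : Y z ->
  m t * enorm (ymax t - z) ^+ 2 <= 4 * (Lb t (x t, ymax t) - Lb t (x t, z)).
Proof.
move=> Yz; exact: (regularized_growth convY (@conc_y t)) Yz (ymax_in t) (m_le t)
  (@ymax_max t).
Qed.

Lemma prog_bounds t : 0 <= prog t <= gapD t.
Proof.
have [prog0 _] := dual_step t; apply/andP; split.
  have : 0 <= m t * enorm (y t.+1 - y t) ^+ 2.
    by rewrite mulr_ge0 ?exprn_ge0 ?enorm_ge0// ltW.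
  lra.
by rewrite lerD2r ymax_max//; exact: iterate_y_in.
Qed.

Lemma step_length t : tau t * G t = enorm (x t.+1 - x t).
Proof.
rewrite /gap_X_PO enormZ_ge0 ?invr_ge0 ?(ltW (tau_gt0 t))//.
by rewrite mulVKf ?gt_eqF// (PO_LMO_x alg).
Qed.

(** The mean value theorem for L(., b') - L(., b), whose gradient is at most
    Lyx |b' - b|: no term of second order in a' - a appears. *)
Lemma diff_mean_value a a' b b' : X a -> X a' -> Y b -> Y b' ->
  (L (a', b') - L (a, b')) - (L (a', b) - L (a, b))
    <= Lyx * enorm (b' - b) * enorm (a' - a).
Proof.
move=> Xa Xa' Yb Yb'.
have Xs (s : R) : 0 <= s <= 1 -> X (a + s *: (a' - a)).
  exact: convex_set_segment.
have df z c : X z -> Y c -> differentiable (fun z => L (z, c)) z.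
  by move=> Xz Yc; exact: (payoff_differentiable_x SA).
have [s s01|s s01] := @grad_mean_value _ _ (fun z => L (z, b') - L (z, b)) a a'.
  by apply: differentiableB; apply: df => //; exact: Xs.
rewrite gradB; [|by apply: df => //; exact: Xs..].
have -> : L (a', b') - L (a', b) - (L (a, b') - L (a, b)) =
  L (a', b') - L (a, b') - (L (a', b) - L (a, b)) by ring.
move=> ->; set z := a + _.
have Xz : X z by exact: Xs.
apply: ler_dotv_enorm.
have := standing_grad_x_lipschitz SA (p := (z, b')) (q := (z, b))
  (conj Xz Yb') (conj Xz Yb).
by rewrite /= subrr enorm0 mulr0 add0r.
Qed.

(** The gradient is compared with the one at (x_t, y_t), which drives the
    projection step, even though the payoff is followed at y_(t+1). *)
Lemma primal_increment t : L (x t.+1, y t.+1) - L (x t, y t.+1)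
  <= - tau t * G t ^+ 2
     + (Lxx * (tau t * G t) + Lyx * enorm (y t.+1 - y t)) * (tau t * G t).
Proof.
have Xx := iterate_x_in t; have Xx' := iterate_x_in t.+1.
have Yy := iterate_y_in t; have Yy' := iterate_y_in t.+1.
have Xs (s : R) : 0 <= s <= 1 -> X (x t + s *: (x t.+1 - x t)).
  exact: convex_set_segment.
have [s s01|s s01 ->] := @grad_mean_value _ _ (fun z => L (z, y t.+1))
    (x t) (x t.+1).
  by apply: (payoff_differentiable_x SA) => //; exact: Xs.
set z := x t + _; have Xz : X z by exact: Xs.
have := PO_step_descent X0 cX convX (grad_x L (x t, y t)) Xx (tau_gt0 t).
rewrite -(PO_LMO_x alg) -step_length => descent.
have := standing_grad_x_lipschitz SA (p := (z, y t.+1)) (q := (x t, y t))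
  (conj Xz Yy') (conj Xx Yy).
have -> : (z, y t.+1).1 - (x t, y t).1 = s *: (x t.+1 - x t).
  by rewrite /z /= addrC addKr.
have [s0 s1] := andP s01; rewrite enormZ_ge0// -step_length => lip.
have lip' : enorm (grad_x L (z, y t.+1) - grad_x L (x t, y t))
    <= Lxx * (tau t * G t) + Lyx * enorm (y t.+1 - y t).
  apply: (le_trans lip); rewrite lerD2r ler_wpM2l ?(standing_Lxx_ge0 SA)//.
  by rewrite ler_piMl// step_length enorm_ge0.
have := ler_dotv_enorm (x t.+1 - x t) lip'.
rewrite -step_length dotvBl.
have -> : - tau t * G t ^+ 2 = - (tau t)^-1 * (tau t * G t) ^+ 2.
  by field; rewrite gt_eqF.
rewrite [grad (fun z => L (z, y t.+1)) z]/(grad_x L (z, y t.+1)); lra.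
Qed.

Context (D : R) (D_le : forall b b', Y b -> Y b' -> enorm (b - b') ^+ 2 <= D).

Let D_ge0 : 0 <= D.
Proof.
by apply: le_trans (D_le (iterate_y_in 0) (iterate_y_in 0)); rewrite sqr_ge0.
Qed.

Let delta t := (beta t - beta t.+1) * (D / 2).

Let delta_ge (c : R) t : c <= D ->
  (beta t - beta t.+1) / 2 * c <= delta t.
Proof.
move=> cD; rewrite /delta mulrAC -mulrA ler_wpM2l ?subr_ge0//.
by rewrite ler_wpM2r.
Qed.

Lemma potential_step t : Lb t.+1 (x t.+1, y t.+1) <= Lb t (x t, y t)
  - tau t * G t ^+ 2
  + (Lxx * (tau t * G t) + Lyx * enorm (y t.+1 - y t)) * (tau t * G t)
  + prog t + delta t.
Proof.
have := primal_increment t.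
have := delta_ge t (D_le (iterate_y_in t.+1) (iterate_y_in 0)).
rewrite /regularized /=; lra.
Qed.

(** The old payoff is compared at the new maximizer, where it is at most the
    old maximum; what remains is the mixed difference of the payoff and the
    change of the regularization. *)
Lemma dual_gap_step t : gapD t.+1 <= gapD t - prog t
  + Lyx * enorm (ymax t.+1 - y t.+1) * (tau t * G t) + delta t.
Proof.
have Yv := ymax_in t.+1.
have := diff_mean_value (iterate_x_in t) (iterate_x_in t.+1)
  (iterate_y_in t.+1) Yv.
rewrite -step_length => mixed.
have := ymax_max t Yv.
have := delta_ge t (D_le Yv (iterate_y_in 0)).
have : 0 <= (beta t - beta t.+1) / 2 * enorm (y t.+1 - y 0%N) ^+ 2.
  by rewrite !mulr_ge0 ?subr_ge0 ?invr_ge0 ?exprn_ge0 ?enorm_ge0.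
rewrite /regularized /= in mixed *; lra.
Qed.

Lemma primal_gap_le t : gap_X_PO X L (tau 0%N) (x t) (y t) <= G t.
Proof. by apply: PO_step_monotone => //; exact: tau_noninc. Qed.

Lemma gap_Y_le t : gap_Y Y L (x t) (y t) <= gapD t + beta t * (D / 2).
Proof.
rewrite /gap_Y lerBlDr; apply: ge_sup.
  by have [b Yb] := Y0; exists (L (x t, b)); exists b.
move=> _ [b Yb <-].
have := ymax_max t Yb.
have : beta t / 2 * enorm (b - y 0%N) ^+ 2 <= beta t * (D / 2).
  by rewrite mulrAC -mulrA ler_wpM2l// ler_wpM2r// D_le//; exact: iterate_y_in.
have : 0 <= beta t / 2 * enorm (y t - y 0%N) ^+ 2.
  by rewrite !mulr_ge0 ?invr_ge0 ?exprn_ge0 ?enorm_ge0.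
rewrite /regularized /=; lra.
Qed.

Lemma beta_le0 t : beta t <= beta 0%N.
Proof. by elim: t => // t; exact: le_trans. Qed.

Lemma regularized_bounded : exists BP : R,
  forall t b, Y b -> `|Lb t (x t, b)| <= BP.
Proof.
have [B B_le] := payoff_bounded SA.
have DE : 0 <= D / 2 by rewrite divr_ge0.
exists (B + beta 0%N * (D / 2)) => t b Yb; rewrite /regularized /=.
have := B_le (x t, b) (conj (iterate_x_in t) Yb).
rewrite !ler_norml => /andP[L1 L2].
have : beta t / 2 * enorm (b - y 0%N) ^+ 2 <= beta 0%N * (D / 2).
  apply: (@le_trans _ _ (beta t * (D / 2)));
    last by rewrite ler_wpM2r// beta_le0.
  by rewrite mulrAC -mulrA ler_wpM2l// ler_wpM2r// D_le//; exact: iterate_y_in.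
have : 0 <= beta t / 2 * enorm (b - y 0%N) ^+ 2.
  by rewrite !mulr_ge0 ?invr_ge0 ?exprn_ge0 ?enorm_ge0.
have := mulr_ge0 (beta_ge0 0) DE.
by move=> *; apply/andP; split; lra.
Qed.

Lemma primal_gap_bounded : exists B : R, forall t, 0 <= G t <= B.
Proof.
have [B _ B_le] := grad_x_bounded SA; exists B => t.
rewrite enorm_ge0 /=; apply: (le_trans (PO_step_le _ _ _ _ _ _)) => //.
  exact: iterate_x_in.
exact: B_le (iterate_x_in t) (iterate_y_in t).
Qed.

(** The oracle maximizes the linear model, so its answer is at least as good
    as the true maximizer, for which concavity bounds the gap. *)
Lemma dual_gap_le_dot t :
  gapD t <= dotv (grad_b t) (ymax t - y t) /\
  gapD t <= dotv (grad_b t) (u t - y t).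
Proof.
have Yy := iterate_y_in t.
have conc : gapD t <= dotv (grad_b t) (ymax t - y t).
  rewrite lerBlDl; exact: (regularized_concave convY (@diff_y t) (@lip_y t)
    (standing_mu_ge0 SA) (@conc_y t) (y 0%N) (beta_ge0 t)) Yy (ymax_in t).
split=> //; apply: (le_trans conc); rewrite !dotvBr lerD2r.
by have [_ /(_ _ (ymax_in t))] := PO_LMO_u alg t; rewrite !dotvNl lerN2.
Qed.

Lemma dual_gap_bounded : exists2 H : R, 0 < H & forall t, gapD t <= H.
Proof.
have [B B_le] := regularized_bounded; exists (2 * B + 1).
  by have := le_trans (normr_ge0 _) (B_le 0%N _ (iterate_y_in 0)); lra.
move=> t; have := B_le t _ (iterate_y_in t); have := B_le t _ (ymax_in t).
rewrite !ler_norml => /andP[_ h1] /andP[h2 _]; lra.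
Qed.

(** The step size is at least h / K, because both h and the denominator of
    the quotient are bounded. *)
Lemma quadratic_progress : exists2 c : R, 0 < c &
  forall t, c * gapD t ^+ 2 <= prog t.
Proof.
have [H H0 H_le] := dual_gap_bounded.
have Lyy0 := standing_Lyy_ge0 SA.
pose K := H + (Lyy + beta 0%N) * D.
have K0 : 0 < K by rewrite ltr_pwDl// mulr_ge0// addr_ge0.
exists (2 * K)^-1 => [|t]; first by rewrite invr_gt0 mulr_gt0.
have [_ gap_dot] := dual_gap_le_dot t.
have gap0 : 0 <= gapD t by have /andP[/le_trans] := prog_bounds t; apply.
have [_ /(_ (gapD t / K) (gapD t))] := dual_step t.
have q01 : 0 <= gapD t / K <= 1.
  rewrite divr_ge0 ?(ltW K0)//= ler_pdivrMr// mul1r (le_trans (H_le t))//.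
  by rewrite lerDl mulr_ge0// addr_ge0.
move=> /(_ q01); rewrite gap0 gap_dot => /(_ isT).
have qle : gapD t / K * ((Lyy + beta t) * enorm (u t - y t) ^+ 2)
    <= dotv (grad_b t) (u t - y t).
  apply: le_trans gap_dot; rewrite -mulrA ler_piMr// ler_pdivrMl// mulr1.
  rewrite /K ler_wpDl ?(ltW H0)//.
  apply: ler_pM; rewrite ?exprn_ge0 ?enorm_ge0 ?addr_ge0//.
    by rewrite lerD2l beta_le0.
  by have [Yu _] := PO_LMO_u alg t; apply: D_le => //; exact: iterate_y_in.
move=> /(_ qle) hK; rewrite invfM -mulrA ler_pdivrMl//.
by apply: le_trans hK; rewrite expr2 mulrA (mulrC K^-1).
Qed.

(** Strong convexity of the set cancels |u - y|^2 in the step size, which is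
    then bounded below by the norm of the gradient; and the gradient is at least
    (m h)^(1/2) / 2 by concavity and quadratic growth. *)
Lemma strongly_convex_progress (alpha : R) : 0 < alpha -> strongly_convex_set
  alpha Y ->
  exists2 c : R, 0 < c &
    forall t, c * (Num.sqrt (m t * gapD t) * gapD t) <= prog t.
Proof.
move=> alpha0 scY; have [H H0 H_le] := dual_gap_bounded.
have Lyy0 := standing_Lyy_ge0 SA; have mu0 := standing_mu_ge0 SA.
pose S := Num.sqrt ((mu + beta 0%N) * H).
pose K := 1 + S + 8 * (Lyy + beta 0%N) / alpha.
have S0 : 0 <= S by exact: sqrtr_ge0.
have LK : 0 <= 8 * (Lyy + beta 0%N) / alpha.
  by rewrite divr_ge0 ?(ltW alpha0)// mulr_ge0// addr_ge0.
have K0 : 0 < K by rewrite /K; lra.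
exists (2 * K)^-1 => [|t]; first by rewrite invr_gt0 mulr_gt0.
have [gap_dot_max gap_dot] := dual_gap_le_dot t.
have gap0 : 0 <= gapD t by have /andP[/le_trans] := prog_bounds t; apply.
have mgap0 : 0 <= m t * gapD t by rewrite mulr_ge0// ltW.
set r := Num.sqrt (m t * gapD t).
have r0 : 0 <= r by exact: sqrtr_ge0.
have rS : r <= S.
  rewrite ler_wsqrtr//; apply: ler_pM => //; first exact: ltW.
  by apply: (le_trans (m_le t)); rewrite lerD2l beta_le0.
have r_grad : r <= 2 * enorm (grad_b t).
  have g0 := enorm_ge0 (grad_b t).
  rewrite -ler_sqr ?nnegrE ?mulr_ge0// sqr_sqrtr//.
  have [gap_eq0|gap_neq0] := eqVneq (gapD t) 0.
    by rewrite gap_eq0 mulr0 exprn_ge0 ?mulr_ge0.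
  have gap_gt0 : 0 < gapD t by rewrite lt_neqAle eq_sym gap_neq0.
  rewrite -(ler_pM2r gap_gt0).
  have gap_CS := le_trans gap_dot_max (dotv_le_enorm _ _).
  have gap_sq : gapD t ^+ 2 <= enorm (grad_b t) ^+ 2 * enorm (ymax t - y t) ^+
    2.
    by rewrite -exprMn ler_sqr ?nnegrE ?mulr_ge0 ?enorm_ge0.
  have := ler_wpM2l (ltW (m_gt0 t)) gap_sq.
  have := ler_wpM2l (sqr_ge0 (enorm (grad_b t))) (@ymax_growth t _
    (iterate_y_in t)).
  move: (gapD t) (enorm (ymax t - y t)) (enorm (grad_b t)) => gp e g; lra.
have [_ /(_ (r / K) (gapD t))] := dual_step t.
have q01 : 0 <= r / K <= 1.
  rewrite divr_ge0 ?(ltW K0)//= ler_pdivrMr// mul1r (le_trans rS)// /K; lra.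
move=> /(_ q01); rewrite gap0 gap_dot => /(_ isT).
have qle : r / K * ((Lyy + beta t) * enorm (u t - y t) ^+ 2)
    <= dotv (grad_b t) (u t - y t).
  apply: (le_trans _ (strongly_convex_LMO scY (iterate_y_in t) (PO_LMO_u alg
    t))).
  rewrite -/(grad_b t) mulrA [leRHS]mulrAC.
  rewrite ler_wpM2r ?exprn_ge0 ?enorm_ge0//.
  apply: (@le_trans _ _ (alpha / 8 * r)).
    have KL : 8 * (Lyy + beta t) <= alpha * K.
      have -> : alpha * K = alpha * (1 + S) + 8 * (Lyy + beta 0%N).
        by rewrite /K; field; rewrite gt_eqF.
      have := mulr_ge0 (ltW alpha0) S0; have := beta_le0 t; lra.
    rewrite mulrAC ler_pdivrMr//; have := ler_wpM2l r0 KL; lra.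
  have := ler_wpM2l (ltW alpha0) r_grad; lra.
move=> /(_ qle) hK; rewrite invfM -mulrA ler_pdivrMl//.
by apply: le_trans hK; rewrite mulrA (mulrC K^-1).
Qed.

(** * Averaged rates *)

Context (a b c1 c2 c3 Cd : R).
Context (c1_gt0 : 0 < c1) (c2_gt0 : 0 < c2) (c3_gt0 : 0 < c3) (Cd_ge0 : 0 <=
  Cd).
Context (tau_ge : forall t, c1 * t.+1%:R `^ (- a) <= tau t)
  (tau_le : forall t, tau t <= c2 * t.+1%:R `^ (- a)).
Context (mE : forall t, m t = c3 * t.+1%:R `^ (- b)).
Context (beta_diff : forall t, beta t - beta t.+1 <= Cd / t.+1%:R).
Context (b_ge0 : 0 <= b) (b_le1 : b <= 1) (b_le_a : b <= a).
Context (a_ge : 1 <= 3 * a) (a_le1 : a <= 1).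

Let N_ge1 t : 1 <= t.+1%:R :> R.
Proof. by rewrite ler1n. Qed.

Let modulus_ratio t : tau t / m t.+1 <= 2 * c2 / c3 * t.+1%:R `^ (b - a).
Proof.
rewrite ler_pdivrMr// (le_trans (tau_le t))// mE.
have -> : b - a = - a - - b by ring.
rewrite powRB ?pnatr_eq0 ?implybT//.
have w0 : 0 < t.+1%:R `^ (- b) :> R by rewrite powR_gt0.
have -> : 2 * c2 / c3 * (t.+1%:R `^ (- a) / t.+1%:R `^ (- b))
    * (c3 * t.+2%:R `^ (- b)) = c2 * t.+1%:R `^ (- a)
    * (2 * t.+2%:R `^ (- b) / t.+1%:R `^ (- b)).
  by field; rewrite !gt_eqF.
rewrite ler_peMr ?mulr_ge0 ?powR_ge0 ?(ltW c2_gt0)//.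
by rewrite ler_pdivlMr// mul1r powR_succ_half.
Qed.

Let ratio_ge0 t : 0 <= tau t / m t.+1.
Proof. by rewrite divr_ge0 ?ltW. Qed.

Let gap0 t : 0 <= gapD t.
Proof. by have /andP[/le_trans] := prog_bounds t; apply. Qed.

Lemma descent_of_progress :
  (forall k, 0 < k -> exists2 E, 0 <= E & forall t,
    tau t / m t.+1 * gapD t.+1 <= k * prog t.+1 + E / t.+1%:R) ->
  exists (V : nat -> R) (BV C : R),
    [/\ 0 <= C, forall t, 0 <= V t <= BV &
        forall t, V t.+1 + (tau t * G t ^+ 2 / 2 + prog t)
          <= V t + C / t.+1%:R].
Proof.
move=> young.
have [B B_le] := primal_gap_bounded.
have [H _ H_le] := dual_gap_bounded.
have [BP BP_le] := regularized_bounded.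
have D2_ge0 : 0 <= D / 2 by rewrite divr_ge0.
apply: (@lyapunov_sequence R Lxx Lyx (c2 / c3) (c2 ^+ 3) (Cd * (D / 2)) H B BP
  tau m (fun t => G t) (fun t => enorm (y t.+1 - y t))
  (fun t => enorm (ymax t.+1 - y t.+1)) (fun t => prog t) (fun t => gapD t)
  (fun t => Lb t (x t, y t)) delta) => //.
- by rewrite divr_ge0 ?ltW.
- by rewrite exprn_ge0 ?ltW.
- by rewrite mulr_ge0.
- move=> t; apply: (le_trans (tau_le t)); rewrite mE mulrA divfK ?gt_eqF//.
  by rewrite ler_wpM2l ?(ltW c2_gt0)// ler_powR// lerN2.
- move=> t; apply: (@le_trans _ _ ((c2 * t.+1%:R `^ (- a)) ^+ 3)).
    by rewrite lerXn2r ?nnegrE ?mulr_ge0 ?powR_ge0 ?(ltW c2_gt0) ?(ltW (tau_gt0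
      t)).
  rewrite exprMn powR_exprn.
  rewrite ler_wpM2l ?exprn_ge0 ?(ltW c2_gt0)// powR_le_inv//.
  by have := a_ge; lra.
- by move=> t; rewrite /delta [leRHS]mulrAC ler_wpM2r.
- by move=> t; exact: prog_bounds.
- by move=> t; apply: BP_le; exact: iterate_y_in.
- by move=> t; have [] := dual_step t.
- by move=> t; exact: (@ymax_growth t.+1 (y t.+1) (iterate_y_in t.+1)).
- by move=> t; exact: potential_step.
- by move=> t; exact: dual_gap_step.
Qed.

(** The geometry of Y enters through two hypotheses: for every k > 0 the error
    of the descent inequality is absorbed by k times the next progress, and
    progress converts into dual gap at the rate N^(s-1). *)
Lemma PO_LMO_rates_of_progress (s K : R) :
  0 < s -> s <= 1 -> 0 <= K ->
  (forall k, 0 < k -> exists2 E, 0 <= E & forall t,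
    tau t / m t.+1 * gapD t.+1 <= k * prog t.+1 + E / t.+1%:R) ->
  (exists2 E, 0 <= E & forall t,
    gapD t <= t.+1%:R `^ s * prog t + E * t.+1%:R `^ (s - 1)) ->
  (forall t, beta t <= K * t.+1%:R `^ (s - 1)) ->
  bigO_rate (average (fun t => gap_X_PO X L (tau 0%N) (x t) (y t)))
    ((1 + a) / 2 - 1) /\
  bigO_rate (average (fun t => gap_Y Y L (x t) (y t))) (s - 1).
Proof.
move=> s0 s1 K0 young [E E0 gapE] beta_le.
have [V [BV [C [C0 V_bnd V_step]]]] := descent_of_progress young.
have prog0 t : 0 <= prog t by have /andP[] := prog_bounds t.
have tG0 t : 0 <= tau t * G t ^+ 2 / 2.
  by rewrite divr_ge0// mulr_ge0 ?sqr_ge0// ltW.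
split.
- have r0 : 0 < (1 + a) / 2 by have := a_ge; lra.
  have r1 : (1 + a) / 2 <= 1 by have := a_le1; lra.
  apply: (telescope_average_rate (K1 := 2 / c1) (K2 := 1) r0 r1 C0 _ _ V_bnd
    V_step) => //.
    by rewrite divr_ge0 ?ltW.
  move=> t; apply: (le_trans (primal_gap_le t)).
  set g := G t; set r := (1 + a) / 2.
  set w := t.+1%:R `^ (r - 1).
  have w0 : 0 < w by rewrite powR_gt0.
  have NaE : t.+1%:R `^ r * t.+1%:R `^ (- a) = w^-1.
    by rewrite -powRD ?pnatr_eq0 ?implybT// /w -powRN; congr (_ `^ _);
      rewrite /r; field.
  (* With w = N^((a-1)/2), the term g^2 / w is N^((1+a)/2) tau_t g^2 up to a
     constant. *)
  have gw : g <= w^-1 * g ^+ 2 + 1 * w.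
    have -> : w^-1 * g ^+ 2 + 1 * w = g + (w^-1 * (g - w / 2) ^+ 2 + 3 / 4 * w).
      by field; rewrite gt_eqF.
    have := mulr_ge0 (ltW w0) (sqr_ge0 (w^-1)).
    have : 0 <= w^-1 * (g - w / 2) ^+ 2 by rewrite mulr_ge0 ?sqr_ge0// invr_ge0
      ltW.
    lra.
  apply: (le_trans gw); rewrite lerD2r -NaE.
  have Nr0 : 0 <= t.+1%:R `^ r :> R by exact: powR_ge0.
  have -> : 2 / c1 * (t.+1%:R `^ r * (tau t * g ^+ 2 / 2 + prog t))
     = t.+1%:R `^ r * (tau t / c1 * g ^+ 2 + 2 / c1 * prog t).
    by field; rewrite gt_eqF.
  rewrite -[leLHS]mulrA ler_wpM2l//.
  have : 0 <= 2 / c1 * prog t by rewrite mulr_ge0 ?divr_ge0 ?(ltW c1_gt0).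
  have : t.+1%:R `^ (- a) * g ^+ 2 <= tau t / c1 * g ^+ 2.
    by rewrite ler_wpM2r ?sqr_ge0// ler_pdivlMr// mulrC.
  lra.
- have D0 : 0 <= D / 2 by rewrite divr_ge0.
  apply: (telescope_average_rate (K1 := 1) (K2 := E + K * (D / 2)) s0 s1 C0 _ _
    V_bnd V_step) => //.
    by rewrite addr_ge0// mulr_ge0.
  move=> t; apply: (le_trans (gap_Y_le t)).
  have := gapE t; have := ler_wpM2r D0 (beta_le t).
  have := mulr_ge0 (powR_ge0 (t.+1%:R : R) s) (tG0 t); lra.
Qed.

Lemma PO_LMO_rates_quadratic (s K : R) :
  1 <= 2 * (a - b) -> 1 / 2 <= s -> s <= 1 -> 0 <= K ->
  (forall t, beta t <= K * t.+1%:R `^ (s - 1)) ->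
  bigO_rate (average (fun t => gap_X_PO X L (tau 0%N) (x t) (y t)))
    ((1 + a) / 2 - 1) /\
  bigO_rate (average (fun t => gap_Y Y L (x t) (y t))) (s - 1).
Proof.
move=> ab s_ge s1 K0 beta_le; have s0 : 0 < s by lra.
have [c c0 prog_ge] := quadratic_progress.
apply: (PO_LMO_rates_of_progress s0 s1 K0) => //.
- move=> k k0; have kc0 : 0 < k * c by rewrite mulr_gt0.
  pose c4 := 2 * c2 / c3.
  have c40 : 0 <= c4 by rewrite divr_ge0 ?mulr_ge0 ?ltW.
  exists (c4 ^+ 2 / (k * c)) => [|t]; first by rewrite divr_ge0 ?sqr_ge0 ?ltW.
  apply: (le_trans (young_quadratic _ _ kc0)); apply: lerD.
    by rewrite -mulrA ler_wpM2l ?(ltW k0).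
  rewrite [leRHS]mulrAC ler_wpM2r ?invr_ge0 ?(ltW kc0)//.
  have := modulus_ratio t; rewrite -/c4 => ratio.
  apply: (@le_trans _ _ ((c4 * t.+1%:R `^ (b - a)) ^+ 2)).
    by rewrite ler_sqr ?nnegrE ?ratio_ge0 ?(mulr_ge0 c40 (powR_ge0 _ _)).
  rewrite exprMn powR_exprn ler_wpM2l ?sqr_ge0// powR_le_inv//; lra.
- exists c^-1 => [|t]; first by rewrite invr_ge0 ltW.
  set w := t.+1%:R `^ s; have w0 : 0 < w by rewrite powR_gt0.
  have wc0 : 0 < w * c by rewrite mulr_gt0.
  rewrite -[leLHS]mul1r; apply: (le_trans (young_quadratic _ _ wc0)).
  apply: lerD; first by rewrite -mulrA ler_wpM2l ?(ltW w0).
  rewrite expr1n div1r invfM mulrC ler_wpM2l ?invr_ge0 ?(ltW c0)//.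
  by rewrite /w -powRN ler_powR//; lra.
Qed.

Lemma PO_LMO_rates_strongly_convex (alpha s K : R) :
  0 < alpha -> strongly_convex_set alpha Y ->
  1 <= 3 * a - 4 * b -> (1 + b) / 3 <= s -> s <= 1 -> 0 <= K ->
  (forall t, beta t <= K * t.+1%:R `^ (s - 1)) ->
  bigO_rate (average (fun t => gap_X_PO X L (tau 0%N) (x t) (y t)))
    ((1 + a) / 2 - 1) /\
  bigO_rate (average (fun t => gap_Y Y L (x t) (y t))) (s - 1).
Proof.
move=> alpha0 scY ab s_ge s1 K0 beta_le.
have s0 : 0 < s by have := b_ge0; lra.
have [c c0 prog_ge] := strongly_convex_progress alpha0 scY.
apply: (PO_LMO_rates_of_progress s0 s1 K0) => //.
- move=> k k0; have kc0 : 0 < k * c by rewrite mulr_gt0.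
  pose c4 := 2 * c2 / c3.
  have c40 : 0 <= c4 by rewrite divr_ge0 ?mulr_ge0 ?ltW.
  exists (2 * c4 ^+ 3 / ((k * c) ^+ 2 * c3)) => [|t].
    exact: divr_ge0 (mulr_ge0 (ler0n _ 2) (exprn_ge0 3 c40))
      (mulr_ge0 (exprn_ge0 2 (ltW kc0)) (ltW c3_gt0)).
  apply: (le_trans (young_three_halves (ratio_ge0 t) kc0 (m_gt0 t.+1) (gap0
    t.+1))).
  apply: lerD; first by rewrite -mulrA ler_wpM2l ?(ltW k0).
  have := modulus_ratio t; rewrite -/c4 => ratio.
  have ratio3 : (tau t / m t.+1) ^+ 3 <= c4 ^+ 3 * t.+1%:R `^ ((b - a) * 3).
    rewrite -powR_exprn -exprMn.
    by rewrite lerXn2r ?nnegrE ?ratio_ge0 ?(mulr_ge0 c40 (powR_ge0 _ _)).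
  have m_inv : (m t.+1)^-1 <= 2 / c3 * t.+1%:R `^ b.
    have w0 : 0 < t.+1%:R `^ (- b) :> R by rewrite powR_gt0.
    rewrite -[t.+1%:R `^ b]invrK -powRN -div1r ler_pdivrMr// mE.
    have -> : 2 / c3 / t.+1%:R `^ (- b) * (c3 * t.+2%:R `^ (- b))
        = 2 * t.+2%:R `^ (- b) / t.+1%:R `^ (- b).
      by field; rewrite !gt_eqF.
    by rewrite ler_pdivlMr// mul1r powR_succ_half.
  have pow_inv : t.+1%:R `^ ((b - a) * 3) * t.+1%:R `^ b <= t.+1%:R^-1 :> R.
    by rewrite -powRD ?pnatr_eq0 ?implybT// powR_le_inv//; lra.
  rewrite invfM mulrA mulrAC.
  have := ler_pM (exprn_ge0 3 (ratio_ge0 t)) _ ratio3 m_inv.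
  rewrite invr_ge0 => /(_ (ltW (m_gt0 t.+1))) prod_le.
  rewrite ler_pdivrMr ?exprn_gt0//; apply: (le_trans prod_le).
  have -> : 2 * c4 ^+ 3 / ((k * c) ^+ 2 * c3) / t.+1%:R * (k * c) ^+ 2
      = 2 * c4 ^+ 3 / c3 * t.+1%:R^-1.
    by field; rewrite !gt_eqF ?ltr0n.
  have -> : c4 ^+ 3 * t.+1%:R `^ ((b - a) * 3) * (2 / c3 * t.+1%:R `^ b)
      = 2 * c4 ^+ 3 / c3 * (t.+1%:R `^ ((b - a) * 3) * t.+1%:R `^ b) by ring.
  rewrite ler_wpM2l//.
  exact: divr_ge0 (mulr_ge0 (ler0n _ 2) (exprn_ge0 3 c40)) (ltW c3_gt0).
- exists (c ^+ 2 * c3)^-1 => [|t].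
    by rewrite invr_ge0; exact: mulr_ge0 (exprn_ge0 2 (ltW c0)) (ltW c3_gt0).
  set w := t.+1%:R `^ s; have w0 : 0 < w by rewrite powR_gt0.
  have wc0 : 0 < w * c by rewrite mulr_gt0.
  rewrite -[leLHS]mul1r.
  apply: (le_trans (young_three_halves ler01 wc0 (m_gt0 t) (gap0 t))).
  apply: lerD; first by rewrite -mulrA ler_wpM2l ?(ltW w0).
  rewrite expr1n div1r mE.
  have -> : ((w * c) ^+ 2 * (c3 * t.+1%:R `^ (- b)))^-1
      = (c ^+ 2 * c3)^-1 * (t.+1%:R `^ (s * 2 - b))^-1.
    have -> : t.+1%:R `^ (s * 2 - b) = w ^+ 2 * t.+1%:R `^ (- b).
      by rewrite /w powR_exprn -powRD ?pnatr_eq0 ?implybT.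
    by rewrite -invfM; congr (_^-1); ring.
  have c2c3 : 0 <= (c ^+ 2 * c3)^-1.
    by rewrite invr_ge0; exact: mulr_ge0 (exprn_ge0 2 (ltW c0)) (ltW c3_gt0).
  rewrite (ler_wpM2l c2c3)//.
  by rewrite -powRN ler_powR//; lra.
Qed.

End Run.

Lemma decaying_regularization_facts (R : realType) (beta : nat -> R) (b : R) :
  0 <= b -> b <= 1 -> decaying_regularization beta b ->
  exists C : R, [/\ 0 < C, forall t, beta t = C * t.+1%:R `^ (- b),
    forall t, 0 <= beta t, forall t, beta t.+1 <= beta t &
    forall t, beta t - beta t.+1 <= C / t.+1%:R].
Proof.
move=> b0 b1 [C C0 betaE]; exists C; split=> // t; rewrite !betaE.
- by rewrite mulr_ge0 ?powR_ge0 ?ltW.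
- rewrite ler_wpM2l ?(ltW C0)// !powRN lef_pV2 ?posrE ?powR_gt0//.
  by rewrite ge0_ler_powR ?nnegrE ?ler_nat.
- by rewrite -mulrBr -[C / _]mulr1 -mulrA (mulrC _ 1) ler_wpM2l ?(ltW C0)//
  powR_decrement.
Qed.

Lemma Theta_stepsize_bounds (R : realType) (tau : nat -> R) (a : R) :
  Theta_stepsize tau a -> exists c1 c2 : R, [/\ 0 < c1, 0 < c2,
    forall t, c1 * t.+1%:R `^ (- a) <= tau t &
    forall t, tau t <= c2 * t.+1%:R `^ (- a)].
Proof.
move=> [c1 [c2 [c10 c12 tau_bnd]]]; exists c1, c2.
by split=> // [|t|t]; [exact: lt_le_trans c12|have /andP[] := tau_bnd t|
  have /andP[] := tau_bnd t].
Qed.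

Theorem theorem4p1 (R : realType) (dx dy : nat)
    (X : set 'rV[R]_dx) (Y : set 'rV[R]_dy)
    (L : 'rV[R]_dx * 'rV[R]_dy -> R) (mu Lxx Lyy Lyx : R)
    (tau beta : nat -> R)
    (x : nat -> 'rV[R]_dx) (y u : nat -> 'rV[R]_dy) :
  standing_assumption X Y L mu Lxx Lyy Lyx ->
  (forall t, 0 < tau t) ->
  nonincreasing_seq tau ->
  PO_LMO X Y L Lyy tau beta x y u ->
  let avgGX := average (fun t => gap_X_PO X L (tau 0%N) (x t) (y t)) in
  let avgGY := average (fun t => gap_Y Y L (x t) (y t)) in
  [/\ (Theta_stepsize tau (2 / 3) ->
       decaying_regularization beta (1 / 6) ->
       softO_rate avgGX (- (1 / 6)) /\ softO_rate avgGY (- (1 / 6))),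
      (0 < mu ->
       Theta_stepsize tau (1 / 2) ->
       (forall t, beta t = 0) ->
       bigO_rate avgGX (- (1 / 4)) /\ softO_rate avgGY (- (1 / 2))),
      ((exists2 alpha, 0 < alpha & strongly_convex_set alpha Y) ->
       Theta_stepsize tau (3 / 5) ->
       decaying_regularization beta (1 / 5) ->
       bigO_rate avgGX (- (1 / 5)) /\ bigO_rate avgGY (- (1 / 5))) &
      (0 < mu ->
       (exists2 alpha, 0 < alpha & strongly_convex_set alpha Y) ->
       Theta_stepsize tau (1 / 3) ->
       (forall t, beta t = 0) ->
       bigO_rate avgGX (- (1 / 3)) /\ softO_rate avgGY (- (2 / 3)))].
Proof.
move=> SA tau0 tau_noninc alg avgGX avgGY.
have [D D_le] := compact_sqr_diameter (standing_Y_nonempty SA)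
  (standing_Y_compact SA).
pose m (c b : R) t := c * t.+1%:R `^ (- b).
have m0 c b : 0 < c -> forall t, 0 < m c b t.
  by move=> c0 t; rewrite mulr_gt0 ?powR_gt0.
have m_mu t : m mu 0 t = mu by rewrite /m oppr0 powRr0 mulr1.
have mu0 := standing_mu_ge0 SA.
split.
- move=> /Theta_stepsize_bounds[c1 [c2 [c10 c20 tau_ge tau_le]]].
  have b0 : 0 <= 1 / 6 :> R by lra.
  have b1 : 1 / 6 <= 1 :> R by lra.
  case/(decaying_regularization_facts b0 b1)=> C [C0 betaE beta0 beta_dec
    beta_diff].
  have ba : 1 / 6 <= 2 / 3 :> R by lra.
  have a3 : 1 <= 3 * (2 / 3) :> R by lra.
  have a1 : 2 / 3 <= 1 :> R by lra.
  have m_le t : m C (1 / 6) t <= mu + beta t by rewrite betaE lerDr.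
  have [|||||GX GY] := PO_LMO_rates_quadratic SA tau0 tau_noninc alg
    (m0 _ _ C0) m_le beta0 beta_dec D_le c10 c20 C0 (ltW C0) tau_ge tau_le
    (fun=> erefl) beta_diff b0 b1 ba a3 a1 (s := 5 / 6) (K := C); try lra.
    by move=> t; rewrite betaE; have -> : 5 / 6 - 1 = - (1 / 6) :> R by lra.
  split; apply: bigO_softO.
    by have -> : - (1 / 6) = (1 + 2 / 3) / 2 - 1 :> R by lra.
  by have -> : - (1 / 6) = 5 / 6 - 1 :> R by lra.
- move=> mu_gt0 /Theta_stepsize_bounds[c1 [c2 [c10 c20 tau_ge tau_le]]] betaE.
  have beta0 t : 0 <= beta t by rewrite betaE.
  have beta_dec t : beta t.+1 <= beta t by rewrite !betaE.
  have beta_diff t : beta t - beta t.+1 <= 0 / t.+1%:R.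
    by rewrite !betaE subrr mul0r.
  have ba : 0 <= 1 / 2 :> R by lra.
  have a3 : 1 <= 3 * (1 / 2) :> R by lra.
  have a1 : 1 / 2 <= 1 :> R by lra.
  have m_le t : m mu 0 t <= mu + beta t by rewrite m_mu lerDl.
  have [|||||GX GY] := PO_LMO_rates_quadratic SA tau0 tau_noninc alg
    (m0 _ _ mu_gt0) m_le beta0 beta_dec D_le c10 c20 mu_gt0 (lexx 0) tau_ge
      tau_le
    (fun=> erefl) beta_diff (lexx 0) ler01 ba a3 a1 (s := 1 / 2) (K := 0);
      try lra.
    by move=> t; rewrite betaE mul0r.
  split; last apply: bigO_softO.
    by have -> : - (1 / 4) = (1 + 1 / 2) / 2 - 1 :> R by lra.
  by have -> : - (1 / 2) = 1 / 2 - 1 :> R by lra.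
- move=> [alpha alpha0 scY].
  move=> /Theta_stepsize_bounds[c1 [c2 [c10 c20 tau_ge tau_le]]].
  have b0 : 0 <= 1 / 5 :> R by lra.
  have b1 : 1 / 5 <= 1 :> R by lra.
  case/(decaying_regularization_facts b0 b1)=> C [C0 betaE beta0 beta_dec
    beta_diff].
  have ba : 1 / 5 <= 3 / 5 :> R by lra.
  have a3 : 1 <= 3 * (3 / 5) :> R by lra.
  have a1 : 3 / 5 <= 1 :> R by lra.
  have m_le t : m C (1 / 5) t <= mu + beta t by rewrite betaE lerDr.
  have [|||||GX GY] := PO_LMO_rates_strongly_convex SA tau0 tau_noninc alg
    (m0 _ _ C0) m_le beta0 beta_dec D_le c10 c20 C0 (ltW C0) tau_ge tau_le
    (fun=> erefl) beta_diff b0 b1 ba a3 a1 alpha0 scY (s := 4 / 5) (K := C);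
      try lra.
    by move=> t; rewrite betaE; have -> : 4 / 5 - 1 = - (1 / 5) :> R by lra.
  split.
    by have -> : - (1 / 5) = (1 + 3 / 5) / 2 - 1 :> R by lra.
  by have -> : - (1 / 5) = 4 / 5 - 1 :> R by lra.
- move=> mu_gt0 [alpha alpha0 scY].
  move=> /Theta_stepsize_bounds[c1 [c2 [c10 c20 tau_ge tau_le]]] betaE.
  have beta0 t : 0 <= beta t by rewrite betaE.
  have beta_dec t : beta t.+1 <= beta t by rewrite !betaE.
  have beta_diff t : beta t - beta t.+1 <= 0 / t.+1%:R.
    by rewrite !betaE subrr mul0r.
  have ba : 0 <= 1 / 3 :> R by lra.
  have a3 : 1 <= 3 * (1 / 3) :> R by lra.
  have a1 : 1 / 3 <= 1 :> R by lra.
  have m_le t : m mu 0 t <= mu + beta t by rewrite m_mu lerDl.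
  have [|||||GX GY] := PO_LMO_rates_strongly_convex SA tau0 tau_noninc alg
    (m0 _ _ mu_gt0) m_le beta0 beta_dec D_le c10 c20 mu_gt0 (lexx 0) tau_ge
      tau_le
    (fun=> erefl) beta_diff (lexx 0) ler01 ba a3 a1 alpha0 scY (s := 1 / 3) (K
      := 0); try lra.
    by move=> t; rewrite betaE mul0r.
  split; last apply: bigO_softO.
    by have -> : - (1 / 3) = (1 + 1 / 3) / 2 - 1 :> R by lra.
  by have -> : - (2 / 3) = 1 / 3 - 1 :> R by lra.
Qed.
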